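(* Let $p$ be a prime and $g\geq 1$ an integer, and let $\Lambda_0\subset\breve N$ be the lattice with $\breve{\mathbb Z}_p$-basis $X_1,\dots,X_g,\Pi X_1,\dots,\Pi X_g$ defined in the context. The set $$\{v\in\breve N\mid (\mathcal D v)_{\tau}=\Lambda_0,\ (\mathcal D v)^{\vee}=\mathcal D v\}$$ (where $\mathcal Dv$ is understood to be a lattice) agrees with the set of elements $v\in\Lambda_0$ obtained in the following way. Write $v$ uniquely as $$v=\sum_{i=1}^g\sum_{l\geq 0}[a_{i,l}]\,\Pi^l X_i,\qquad a_{i,l}\in\overline{\mathbb F}_p .$$ Then: (1) The $a_{i,l}$ with $i\leq\lceil\tfrac{g+1}{2}\rceil$ can be chosen arbitrarily under the condition that the $a_{i,0}$ (with $i\leq\lceil\tfrac{g+1}{2}\rceil$) are linearly independent over $\mathbb F_{p^2}$. (2) The $a_{i,l}$ for $i>\lceil\tfrac{g+1}{2}\rceil$ and $l\geq g-1$ can also be chosen arbitrarily. (3) The $a_{i,0}$ for $i>\lceil\tfrac{g+1}{2}\rceil$ are defined as $a_{i,0}:=z_{g+1-i}$, where $(z_1,\dots,z_{\lfloor (g-1)/2\rfloor})$ is any solution in $\overline{\mathbb F}_p$ of the system of equations $$\sum_{i=1}^{\lfloor (g-1)/2\rfloor}\bigl((-1)^{g-1}z_i\,a_{i,0}^{\sigma^j}+z_i^{\sigma^j}a_{i,0}\bigr)=d_{j,0}$$ for $1\leq j<g-1$ and $j\equiv g\pmod 2$. Here $$d_{j,0}=\begin{cases}-a_{g/2,0}\,a_{g/2+1,0}^{\sigma^j}+a_{g/2,0}^{\sigma^j}\,a_{g/2+1,0}&\text{if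 } g\text{ is even},\\ (-1)^m a_{m,0}\,a_{m,0}^{\sigma^j}&\text{if } g\text{ is odd, with } m=\tfrac{g+1}{2}.\end{cases}$$ (4) The $a_{i,l}$ for $i>\lceil\tfrac{g+1}{2}\rceil$ and $1\leq l<g-1$ are chosen iteratively for increasing $l$. For some fixed $0\leq l\leq g-2$ and $i>\lceil\tfrac{g+1}{2}\rceil$ let $a_{i,l}:=z_{g+1-i}$, where $(z_1,\dots,z_{\lfloor (g-1)/2\rfloor})$ is any solution in $\overline{\mathbb F}_p$ of the system of equations of the form $$\sum_{i=1}^{\lfloor (g-1)/2\rfloor}\bigl((-1)^{g-1}z_i\,a_{i,0}^{\sigma^j}+z_i^{\sigma^j}a_{i,0}\bigr)=d_{j,l}$$ for $1\leq j<g-1-l$ and $j\equiv g+l\pmod 2$. Here the $j$-th such equation is obtained by reducing the expression $$\langle v,F^jv\rangle=\sum_{i=1}^g\sum_{r,s\geq 0}(-1)^r[a_{i,r}a_{g+1-i,s}^{\sigma^j}]\,\langle X_i,\Pi^{r+s+j}X_{g+1-i}\rangle,$$ which by the induction on $l$ is contained in $p^{(j+l-g)/2}\breve{\mathbb Z}_p$, modulo $p^{(j+l-g)/2+1}\breve{\mathbb Z}_p$ (and requiring that this reduction vanishes). In particular, the linear independence over $\mathbb F_{p^2}$ of the $a_{i,0}$ for $i\leq\lceil\tfrac{g+1}{2}\rceil$ implies linear independence over $\mathbb F_{p^2}$ of all $a_{i,0}$, $1\leq i\leq g$.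
   Context: Let $\breve{\mathbb Z}_p=W(\overline{\mathbb F}_p)$ with fraction field $\breve{\mathbb Q}_p$; $\sigma$ is the $p$-power Frobenius on $\overline{\mathbb F}_p$ and its lift to $\breve{\mathbb Q}_p$; write $a^{\sigma^j}=\sigma^j(a)$; $[a]$ is the Teichmüller lift of $a\in\overline{\mathbb F}_p$. Let $\breve N$ be the $\breve{\mathbb Q}_p$-vector space with basis $e_1,\dots,e_g,f_1,\dots,f_g$. Let $F:\breve N\to\breve N$ be the $\sigma$-linear map with $F(e_i)=f_i$, $F(f_i)=pe_i$; $V=pF^{-1}$; $\tau=p^{-1}F^2$; and let $\Pi$ be the $\breve{\mathbb Q}_p$-linear map with $\Pi e_i=f_i$, $\Pi f_i=pe_i$. Let $\langle\cdot,\cdot\rangle$ be the symplectic pairing with $\langle e_i,f_{g+1-i}\rangle=-\langle f_i,e_{g+1-i}\rangle=1$ for all $i$ and all other pairings of basis vectors zero. For a lattice $M\subset\breve N$ (a free $\breve{\mathbb Z}_p$-submodule of rank $2g$), $M^\vee=\{x\in\breve N\mid\langle x,M\rangle\subseteq\breve{\mathbb Z}_p\}$. Let $\mathcal D$ be the Dieudonné ring generated over $\breve{\mathbb Z}_p$ by $F,V$ with relations $Fa=\sigma(a)F$, $aV=V\sigma(a)$, $FV=VF=p$; so $\mathcal Dv$ is the smallest $\breve{\mathbb Z}_p$-submodule of $\breve N$ containing $v$ and stable under $F$ and $V$. For a lattice $M$ stable under $F$ and $V$, $M_\tau=\sum_{i\ge0}\tau^i(M)$ is the smallest $\tau$-stable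 lattice containing $M$. Set $X_i=e_i$ for $i<\tfrac{g+1}{2}$, $X_i=\Pi^{-g+1}e_i$ for $i>\tfrac{g+1}{2}$, and, if $g$ is odd and $m=\tfrac{g+1}{2}$, $X_m=\Pi^{(-g+1)/2}e_m$. Let $\Lambda_0$ be the $\breve{\mathbb Z}_p$-lattice with basis $X_1,\dots,X_g,\Pi X_1,\dots,\Pi X_g$.
   Formalization: In the system of (4), the printed sign (-1)^{g-1} is corrected to (-1)^{g-1+l}, which is what reducing the displayed expansion of <v,F^j v> gives; the two agree for l even or p=2, and the printed sign fails e.g. for g=4, l=j=1, p odd. *)

(* Defs.v *)
(* Plain MathComp, with [set T] (predicates T -> Prop) from mathcomp.classical. *)
From HB Require Import structures.
From mathcomp Require Import all_boot all_order all_algebra.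
From mathcomp Require Import generic_quotient fraction.
From mathcomp Require Import classical_sets.

Set Implicit Arguments.
Unset Strict Implicit.
Unset Printing Implicit Defensive.

Import GRing.Theory.
Local Open Scope classical_set_scope.
Local Open Scope ring_scope.

(* For a perfect field k of characteristic p, W(k) is the strict p-ring with
   residue field k: p is not a zero divisor, W is p-adically separated and
   complete, and W/pW = k.  This determines (W, red) up to a unique
   isomorphism (Serre, Local Fields, II.5).  On such a ring the Teichmueller
   lift is the only multiplicative section of the reduction map, and the Witt
   vector Frobenius the only ring endomorphism lifting x |-> x ^ p; the latter
   is bijective since k is perfect. *)
Record witt_ring (p : nat) (k : fieldType) := WittRing {
  witt_carrier :> idomainType;
  red : {rmorphism witt_carrier -> k};
  teich : k -> witt_carrier;
  frob : {rmorphism witt_carrier -> witt_carrier};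
  frobV : {rmorphism witt_carrier -> witt_carrier};
  witt_p_neq0 : p%:R != 0 :> witt_carrier;
  red_surj : forall a, exists x, red x = a;
  red_eq0 : forall x, red x = 0 <-> exists y, x = p%:R * y;
  witt_separated : forall x : witt_carrier,
    (forall n, exists y, x = p%:R ^+ n * y) -> x = 0;
  witt_complete : forall u : nat -> witt_carrier,
    (forall n, exists y, u n.+1 - u n = p%:R ^+ n * y) ->
    exists x, forall n, exists y, x - u n = p%:R ^+ n * y;
  teichM : forall a b, teich (a * b) = teich a * teich b;
  teichK : forall a, red (teich a) = a;
  red_frob : forall x, red (frob x) = red x ^+ p;
  frobK : cancel frob frobV;
  frobVK : cancel frobV frob
}.

(* The extension of an injective endomorphism of R to its fraction field; the
   value does not depend on the representative, see frac_mapE. *)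
Definition frac_map (R : idomainType) (s : {rmorphism R -> R})
    (x : {fraction R}) : {fraction R} :=
  tofrac (s (frac (repr x)).1) / tofrac (s (frac (repr x)).2).

Lemma frac_numden (R : idomainType) (x : {fraction R}) :
  x = tofrac (frac (repr x)).1 / tofrac (frac (repr x)).2.
Proof.
have d0 := denom_ratioP (repr x).
apply/(canRL (mulfK _)); first by rewrite tofrac_eq0.
rewrite -{1}[x]reprK; unlock FracField.tofrac.
rewrite -[LHS]FracField.pi_mul /FracField.mulf /= !numden_Ratio ?oner_neq0 //.
apply/eqP; rewrite FracField.equivf_def /=.
by rewrite !numden_Ratio ?mulf_neq0 ?oner_neq0 // !mulr1 mulrC.
Qed.

Lemma frac_mapE (R : idomainType) (s : {rmorphism R -> R}) (x y : R) :
  injective s -> y != 0 ->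
  frac_map s (tofrac x / tofrac y) = tofrac (s x) / tofrac (s y).
Proof.
move=> s_inj y0; rewrite /frac_map.
have s_neq0 z : z != 0 -> tofrac (s z) != 0.
  by move=> z0; rewrite tofrac_eq0 -(rmorph0 s) (inj_eq s_inj).
set z := tofrac x / tofrac y; have d0 := denom_ratioP (repr z).
have := frac_numden z; rewrite {1}/z => /eqP.
rewrite eqr_div ?tofrac_eq0 // -!tofracM tofrac_eq => /eqP E.
apply/eqP; rewrite eqr_div ?s_neq0 // -!tofracM tofrac_eq -!rmorphM.
by rewrite E.
Qed.

Lemma frac_mapK (R : idomainType) (s t : {rmorphism R -> R}) :
  cancel s t -> injective t -> cancel (frac_map s) (frac_map t).
Proof.
move=> sK t_inj x; have d0 := denom_ratioP (repr x).
rewrite [frac_map s x]/frac_map frac_mapE //.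
  by rewrite !sK -frac_numden.
by rewrite -(rmorph0 s) (inj_eq (can_inj sK)).
Qed.

Section Isocrystal.
Context {p : nat} {k : fieldType} (W : witt_ring p k) (g : nat).

Notation K := {fraction witt_carrier W}.

Definition sigma : K -> K := frac_map (frob W).
Definition sigmaV : K -> K := frac_map (frobV W).

Lemma sigmaK : cancel sigma sigmaV.
Proof. by apply: frac_mapK; [exact: frobK | apply: can_inj; exact: frobVK]. Qed.

Lemma sigmaVK : cancel sigmaV sigma.
Proof. by apply: frac_mapK; [exact: frobVK | apply: can_inj; exact: frobK]. Qed.

(* (x, y) stands for \sum_i (x_i e_i + y_i f_i). *)
Definition Nspace := ('rV[K]_g * 'rV[K]_g)%type.

(* Vectors of the basis are numbered from 1, as are the X_i below. *)
Definition basis_e (i : nat) : Nspace :=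
  (\row_(j < g) (j.+1 == i)%:R, 0).

Definition basis_f (i : nat) : Nspace :=
  (0, \row_(j < g) (j.+1 == i)%:R).

Definition Fmap (v : Nspace) : Nspace :=
  (p%:R *: map_mx sigma v.2, map_mx sigma v.1).

Definition Finv (v : Nspace) : Nspace :=
  (map_mx sigmaV v.2, map_mx sigmaV (p%:R^-1 *: v.1)).

Definition Vmap (v : Nspace) : Nspace := p%:R *: Finv v.

Definition taumap (v : Nspace) : Nspace := p%:R^-1 *: Fmap (Fmap v).

Definition Pi (v : Nspace) : Nspace := (p%:R *: v.2, v.1).

Definition Piinv (v : Nspace) : Nspace := (v.2, p%:R^-1 *: v.1).

Lemma frac_p_neq0 : p%:R != 0 :> K.
Proof. by rewrite -(rmorph_nat (@FracField.tofrac W)) tofrac_eq0 witt_p_neq0. Qed.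

Lemma FmapK : cancel Fmap Finv.
Proof.
case=> x y; congr pair; apply/rowP => i; rewrite !mxE ?sigmaK //.
by rewrite mulKf ?frac_p_neq0 // sigmaK.
Qed.

Lemma FinvK : cancel Finv Fmap.
Proof.
case=> x y; congr pair; apply/rowP => i; rewrite !mxE ?sigmaVK //.
by rewrite mulVKf ?frac_p_neq0.
Qed.

Lemma PiK : cancel Pi Piinv.
Proof. by case=> x y; rewrite /Piinv /= scalerA mulVf ?frac_p_neq0 ?scale1r. Qed.

Lemma PiinvK : cancel Piinv Pi.
Proof. by case=> x y; rewrite /Pi /= scalerA divff ?frac_p_neq0 ?scale1r. Qed.

Definition pairing (v w : Nspace) : K :=
  \sum_(i < g) (v.1 0 i * w.2 0 (rev_ord i) - v.2 0 i * w.1 0 (rev_ord i)).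

Definition submodule (M : set Nspace) : Prop :=
  [/\ M 0, forall x y, M x -> M y -> M (x + y)
    & forall (c : W) x, M x -> M (tofrac c *: x)].

Definition is_lattice (M : set Nspace) : Prop :=
  exists b : 'I_(2 * g) -> Nspace,
    (forall c : 'I_(2 * g) -> W,
       \sum_i tofrac (c i) *: b i = 0 -> forall i, c i = 0) /\
    M = [set x | exists c : 'I_(2 * g) -> W, x = \sum_i tofrac (c i) *: b i].

Definition dual (M : set Nspace) : set Nspace :=
  [set x | forall y, M y -> exists c : W, pairing x y = tofrac c].

Definition Dmod (v : Nspace) : set Nspace :=
  [set x | forall M : set Nspace, submodule M -> M v ->
     (forall y, M y -> M (Fmap y)) -> (forall y, M y -> M (Vmap y)) -> M x].

Definition tau_closure (M : set Nspace) : set Nspace :=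
  [set x | exists n (y : 'I_n -> Nspace),
     (forall i, M (y i)) /\ x = \sum_(i < n) iter i taumap (y i)].

(* Here i < (g+1)/2 is written 2i < g+1, and similarly for equality. *)
Definition Xvec (i : nat) : Nspace :=
  if (i.*2 < g.+1)%N then basis_e i
  else if i.*2 == g.+1 then iter (g.-1)./2 Piinv (basis_e i)
  else iter g.-1 Piinv (basis_e i).

Definition Lambda0 : set Nspace :=
  [set x | exists c d : nat -> W,
     x = \sum_(1 <= i < g.+1)
           (tofrac (c i) *: Xvec i + tofrac (d i) *: Pi (Xvec i))].

(* v = \sum_(1 <= i <= g) \sum_(l >= 0) [a_{i,l}] Pi^l X_i, for the topology
   given by the neighbourhoods Pi^n Lambda_0 of 0 (equivalently, the p-adic
   one, as Pi^2 = p).  Only the a i l with 1 <= i <= g matter. *)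
Definition expansion (v : Nspace) (a : nat -> nat -> k) : Prop :=
  forall n, exists2 y, Lambda0 y &
    v - \sum_(1 <= i < g.+1) \sum_(0 <= l < n)
          tofrac (teich W (a i l)) *: iter l Pi (Xvec i) = iter n Pi y.

(* p ^ n W, for n possibly negative. *)
Definition pideal (n : int) : set K :=
  [set x | exists w : W, x = (p%:R ^ n) * tofrac w].

(* The partial sums (r, s < n) of the expansion of <v, F^j v>. *)
Definition pairing_sum (a : nat -> nat -> k) (j n : nat) : K :=
  \sum_(1 <= i < g.+1) \sum_(0 <= r < n) \sum_(0 <= s < n)
    (-1) ^+ r * tofrac (teich W (a i r * a (g.+1 - i)%N s ^+ (p ^ j)))
      * pairing (Xvec i) (iter (r + s + j) Pi (Xvec (g.+1 - i))).

(* (j + l - g) / 2, used only when j + l and g have the same parity. *)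
Definition level (l j : nat) : int := (((j + l)%:Z - g%:Z) %/ 2)%Z.

Definition level_range (l j : nat) : bool :=
  [&& (1 <= j)%N, (j < g.-1 - l)%N & j == g + l %[mod 2]].

(* The reduction of <v, F^j v> modulo p ^ ((j + l - g) / 2 + 1) vanishes. *)
Definition reduction_vanishes (v : Nspace) (l j : nat) : Prop :=
  pideal (level l j + 1) (pairing v (iter j Fmap v)).

End Isocrystal.

Arguments Fmap {p k W g} v.
Arguments Finv {p k W g} v.
Arguments Vmap {p k W g} v.
Arguments taumap {p k W g} v.
Arguments Pi {p k W g} v.
Arguments Piinv {p k W g} v.
Arguments Lambda0 {p k} W g _.
Arguments pideal {p k} W n _.
Arguments pairing_sum {p k} W g a j n.

Section Coefficients.
Context (p : nat) {k : fieldType} (g : nat).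
Implicit Types a : nat -> nat -> k.

(* Linear independence of b_1, ..., b_n over the subfield
   F_{p^2} = {x | x^{p^2} = x} of k. *)
Definition free_Fp2 (n : nat) (b : nat -> k) : Prop :=
  forall c : nat -> k,
    (forall i, (1 <= i <= n)%N -> c i ^+ (p ^ 2) = c i) ->
    \sum_(1 <= i < n.+1) c i * b i = 0 ->
    forall i, (1 <= i <= n)%N -> c i = 0.

(* \sum_i (eps z_i a_{i,0}^{sigma^j} + z_i^{sigma^j} a_{i,0}),
   for 1 <= i <= floor((g-1)/2), with z_i = a_{g+1-i,l}. *)
Definition system_lhs (eps : k) a (l j : nat) : k :=
  \sum_(1 <= i < (g.-1)./2.+1)
    (eps * a (g.+1 - i)%N l * a i 0%N ^+ (p ^ j)
     + a (g.+1 - i)%N l ^+ (p ^ j) * a i 0%N).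

Definition d0 a (j : nat) : k :=
  if odd g then
    let m := (g.+1)./2 in (-1) ^+ m * a m 0%N * a m 0%N ^+ (p ^ j)
  else
    let h := g./2 in
    - a h 0%N * a h.+1 0%N ^+ (p ^ j) + a h 0%N ^+ (p ^ j) * a h.+1 0%N.

(* Note that uphalf n is the ceiling of n / 2. *)
Definition leading_free a : Prop :=
  free_Fp2 (uphalf g.+1) (fun i => a i 0%N).

Definition system0 a : Prop :=
  forall j, level_range g 0 j -> system_lhs ((-1) ^+ g.-1) a 0 j = d0 a j.

Definition admissible (W : witt_ring p k) (v : Nspace W g) a : Prop :=
  [/\ leading_free a, system0 a
    & forall l j, (1 <= l)%N -> level_range g l j -> reduction_vanishes v l j].

End Coefficients.

(* Main.v *)
Require Import Defs.
From HB Require Import structures.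
From mathcomp Require Import all_boot all_order all_algebra.
From mathcomp Require Import generic_quotient fraction.
From mathcomp Require Import classical_sets.
From mathcomp Require Import zify ring.

Set Implicit Arguments.
Unset Strict Implicit.
Unset Printing Implicit Defensive.

Import GRing.Theory.
Local Open Scope classical_set_scope.
Local Open Scope ring_scope.

(** Put [Pi] and [sigma] side by side: in the coordinates of the [X_i] the
    isocrystal is a free module over the ramified quadratic extension of the
    Witt ring with uniformiser [Pi], where [Pi^2 = p]; the lattice [Lambda_0] is
    the standard one, and [F = Pi sigma], [V = Pi sigma^-1], [tau = sigma^2] for
    the coordinatewise Frobenius [sigma].  The Gram matrix of the [X_i] gives
    < x, Pi^g y > = \sum_i eps_i (c_i c'_{i'} - p d_i d'_{i'}), with
    [i' = g + 1 - i], for [x = (c, d)] and [y = (c', d')] in [Lambda_0]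
    ([pairing_emb]).  It is an integral form whose reduction is a perfect form
    on the residue space k^g ([revform]), and since [Pi] is skew it controls
    every pairing on [Lambda_0].

    Linear algebra over F_{p^2} enters through Moore determinants: if
    [a_1, ..., a_n] are independent over F_{p^2}, then so are over [k] the [n]
    vectors [sigma^(2s) a] with [s < n] ([moore_row_free]).  Given the equations
    of level zero, the vectors [sigma^(2s) a] span subspaces that are orthogonal
    for the reduced form and of complementary dimension, which upgrades the
    independence of [a_1, ..., a_ceil((g+1)/2)] to that of all the [a_i]
    ([free_all]).

    The congruences at the successive levels say nothing but that
    < v, F^j v > is integral for every [j] ([admissibleP]): the last congruence
    for a given [j] is integrality itself, and it implies all previous ones.
    In the expansion of < v, F^j v > the unknowns of level [l] occur for the
    first time at the precision of level [l], multiplied by digits of level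
    zero, whence the shape of the equations ([spair_unknown], [reduction_eq]).

    If the tau-closure of [D v] is [Lambda_0], the residues [sigma^(2s) a] span
    k^g, so that the [a_i] are independent ([free_of_tau_closure]); and
    self-duality makes all < v, F^j v > integral.  Conversely, integrality makes
    [D v] isotropic ([Dmod_isotropic]).  The submodule [D v] contains, in
    [Pi^n Lambda_0], the elements [F^s V^(n-s) v] with residues
    [sigma^(2s-n) a], of which [min(n+1, g)] are independent.  So [D v] contains
    [Pi^(g-1) Lambda_0], is free on [v, F v, ..., F^g v, V v, ..., V^(g-1) v]
    ([DmodE], [Dmod_lattice]), has tau-closure [Lambda_0] ([Dmod_tau_closure]),
    and, the dimensions [n + 1] and [g - 1 - n] at the levels [n] and
    [g - 2 - n] adding up to [g], equals its dual ([Dmod_dual]). *)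

(** * The ring of Witt vectors *)

Section WittRing.
Context {p : nat} {k : fieldType} (W : witt_ring p k) (p_prime : prime p).

Lemma red_p : red W p%:R = 0.
Proof. by apply/red_eq0; exists 1; rewrite mulr1. Qed.

Lemma residue_char : p \in [pchar k].
Proof. by rewrite inE p_prime /= -(rmorph_nat (red W)) red_p. Qed.

(** The bijectivity of the Frobenius of [W] makes [k] perfect. *)
Lemma residue_root n (a : k) : exists b, b ^+ (p ^ n) = a.
Proof.
elim: n => [|n [b <-]]; first by exists a.
have [x <-] := red_surj W b.
exists (red W (frobV W x)).
by rewrite expnSr mulnC exprM -red_frob frobVK.
Qed.

Lemma teich0 : teich W 0 = 0.
Proof.
have: teich W 0 * (1 - teich W 0) = 0.
  by rewrite mulrBr mulr1 -teichM mulr0 subrr.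
move/eqP; rewrite mulf_eq0 => /orP[/eqP //|/eqP E].
have := congr1 (red W) E.
by rewrite rmorphB rmorph1 teichK rmorph0 subr0 => /eqP; rewrite oner_eq0.
Qed.

Lemma teichX a n : teich W (a ^+ n.+1) = teich W a ^+ n.+1.
Proof. by elim: n => // n IH; rewrite exprS teichM IH -exprS. Qed.

(** Raising to the power [p] improves a congruence by one power of [p]: in
    x^p - y^p = (x - y) \sum x^(p-1-i) y^i the sum has p terms that agree
    modulo p. *)
Lemma expr_congr x y n : red W x = red W y ->
  exists z, x ^+ (p ^ n) - y ^+ (p ^ n) = p%:R ^+ n.+1 * z.
Proof.
move=> xy; elim: n => [|n [z E]].
  by apply/red_eq0; rewrite rmorphB /= xy subrr.
rewrite expnSr !exprM subrXX E.
set S := \sum_(i < p) _.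
have [u ->] : exists u, S = p%:R * u.
  apply/red_eq0; rewrite /S rmorph_sum /=.
  under eq_bigr => i _.
    rewrite rmorphM !rmorphXn /= xy -exprD subnK ?(ltn_predK (prime_gt0 _)) //;
      last by rewrite -ltnS prednK ?prime_gt0.
    over.
  by rewrite sumr_const card_ord -mulr_natl -(rmorph_nat (red W)) red_p mul0r.
by exists (z * u); rewrite [in RHS]exprSr mulrACA.
Qed.

(** The Teichmueller lift of [a] is a [p^n]-th power for every [n], so it is
    determined by its reduction; this forces compatibility with Frobenius. *)
Lemma frob_teich a : frob W (teich W a) = teich W (a ^+ p).
Proof.
apply/eqP; rewrite -subr_eq0; apply/eqP; apply: witt_separated => -[|n].
  by exists (frob W (teich W a) - teich W (a ^+ p)); rewrite mul1r.
have [b <-] := residue_root n a.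
have pn_gt0 : (0 < p ^ n)%N by rewrite expn_gt0 prime_gt0.
rewrite -[_ ^+ p]exprM mulnC exprM -(prednK pn_gt0) !teichX rmorphXn /=.
by rewrite prednK //; apply: expr_congr; rewrite red_frob !teichK.
Qed.

Lemma red_iter_frob n x : red W (iter n (frob W) x) = red W x ^+ (p ^ n).
Proof. by elim: n => //= n IH; rewrite red_frob IH -exprM -expnSr. Qed.

(** [1 - p z] is inverted by the geometric series, which converges
    [p]-adically. *)
Lemma witt_unit x : red W x != 0 -> x \is a GRing.unit.
Proof.
move=> x_neq0; have [y ry] := red_surj W (red W x)^-1.
have [z Ez] : exists z, 1 - x * y = p%:R * z.
  by apply/red_eq0; rewrite rmorphB rmorphM rmorph1 /= ry divff // subrr.
have [|s Hs] := witt_complete (w := W) (u := fun n => \sum_(i < n) (p%:R * z) ^+ i).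
  by move=> n; exists (z ^+ n); rewrite big_ord_recr /= addrAC subrr add0r exprMn.
suff xys : x * (y * s) = 1.
  by apply/unitrP; exists (y * s); rewrite mulrC xys.
apply/eqP; rewrite -subr_eq0; apply/eqP; apply: witt_separated => n.
have [t Et] := Hs n.
exists (x * y * t - z ^+ n).
have -> : x * (y * s) - 1 = x * y * (s - \sum_(i < n) (p%:R * z) ^+ i)
    - (1 - x * y * \sum_(i < n) (p%:R * z) ^+ i).
  by rewrite mulrBr opprB addrA subrK mulrA.
have -> : x * y = 1 - p%:R * z by rewrite -Ez subKr.
have -> : 1 - (1 - p%:R * z) * \sum_(i < n) (p%:R * z) ^+ i = (p%:R * z) ^+ n.
  rewrite -[RHS](subKr 1); congr (_ - _).
  have := subrXX 1 (p%:R * z) n; rewrite expr1n => ->; congr (_ * _).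
  by apply: eq_bigr => i _; rewrite expr1n mul1r.
by rewrite Et exprMn mulrBr mulrCA.
Qed.

End WittRing.

(** * Moore determinants over F_{p^2} *)

Section Moore.
Context {p : nat} {k : fieldType} (p_char : p \in [pchar k]).

Let pexp_gt0 n : (0 < p ^ n)%N.
Proof. by rewrite expn_gt0 (prime_gt0 (pcharf_prime p_char)). Qed.

Lemma pexp_eq0 n (x : k) : (x ^+ (p ^ n) == 0) = (x == 0).
Proof. by rewrite expf_eq0 pexp_gt0. Qed.

Lemma expr0_pexp n : 0 ^+ (p ^ n) = 0 :> k.
Proof. by apply/eqP; rewrite pexp_eq0. Qed.

Lemma sum_expr_pchar (I : Type) (r : seq I) (P : pred I) (f : I -> k) n :
  (\sum_(i <- r | P i) f i) ^+ (p ^ n) = \sum_(i <- r | P i) f i ^+ (p ^ n).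
Proof.
apply: (big_morph (fun x => x ^+ (p ^ n))) => [x y|]; last exact: expr0_pexp.
by apply: exprDn_pchar; rewrite pnatX (eq_pnat _ (pcharf_eq p_char)) pnat_id
  ?(pcharf_prime p_char).
Qed.

Lemma free_Fp2_leq m n (b : nat -> k) :
  (m <= n)%N -> free_Fp2 p n b -> free_Fp2 p m b.
Proof.
move=> mn b_free c c2 cb i /andP[i_gt0 im].
have := b_free (fun j => if (j <= m)%N then c j else 0).
move=> /(_ _ _ i); rewrite im i_gt0 (leq_trans im mn); apply=> // [j /andP[j_gt0 _]|].
  by case: ifP => jm; [apply: c2; rewrite j_gt0 | rewrite expr0_pexp].
rewrite (big_cat_nat _ (n := m.+1)) //= [X in _ + X]big_nat [X in _ + X]big1 ?addr0.
  by rewrite -[RHS]cb big_nat [RHS]big_nat; apply: eq_bigr => j /andP[_];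
     rewrite ltnS => ->.
by move=> j /andP[mj _]; rewrite leqNgt mj mul0r.
Qed.

Lemma free_Fp2_pexp n (b : nat -> k) m :
  free_Fp2 p n b -> free_Fp2 p n (fun i => b i ^+ (p ^ m)).
Proof.
move=> b_free c c2 cb i i_n.
(* c is its own p^(2m)-th power, so it has the p^m-th root c^(p^m) *)
have c_root j : (1 <= j <= n)%N -> (c j ^+ (p ^ m)) ^+ (p ^ m) = c j.
  move=> j_n; rewrite -exprM -expnD addnn -mul2n.
  by elim: (m) => [|q IH]; rewrite ?muln0 // mulnS expnD exprM c2.
have : c i ^+ (p ^ m) = 0.
  apply: (b_free (fun j => c j ^+ (p ^ m))) => // [j j_n|].
    by rewrite exprAC c2.
  apply/eqP; rewrite -(pexp_eq0 m) sum_expr_pchar; apply/eqP.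
  rewrite -[RHS]cb big_nat [RHS]big_nat; apply: eq_bigr => j j_n.
  by rewrite exprMn c_root.
by move/eqP; rewrite pexp_eq0 => /eqP.
Qed.

Lemma free_Fp2_root n (b : nat -> k) m :
  free_Fp2 p n (fun i => b i ^+ (p ^ m)) -> free_Fp2 p n b.
Proof.
move=> b_free c c2 cb i i_n.
have : c i ^+ (p ^ m) = 0.
  apply: (b_free (fun j => c j ^+ (p ^ m))) => // [j j_n|].
    by rewrite exprAC c2.
  under eq_bigr do rewrite -exprMn.
  by rewrite -sum_expr_pchar cb expr0_pexp.
by move/eqP; rewrite pexp_eq0 => /eqP.
Qed.

(** Normalise a kernel vector of the Moore matrix to have last entry [1] and
    subtract its [p^2]-Frobenius twist: the difference is a kernel vector of a
    smaller Moore matrix, hence zero, so the normalised vector is a relation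
    over F_{p^2}. *)
Lemma moore_kernel n (b c : nat -> k) : free_Fp2 p n b ->
  (forall s, (s < n)%N -> \sum_(1 <= i < n.+1) c i * b i ^+ (p ^ (2 * s)) = 0) ->
  forall i, (1 <= i <= n)%N -> c i = 0.
Proof.
elim: n b c => [|n IH] b c b_free cb; first by case.
suff c_last : c n.+1 = 0.
  move=> i /andP[i_gt0]; rewrite leq_eqVlt => /orP[/eqP -> //|i_n].
  apply: (IH b) => //; last by rewrite i_gt0.
    exact: free_Fp2_leq b_free.
  move=> s sn; have := cb s (ltnW sn).
  by rewrite big_nat_recr //= c_last mul0r addr0.
apply/eqP; apply: contraT => c_neq0.
pose e i := c i / c n.+1.
have eb s : (s <= n)%N -> \sum_(1 <= i < n.+2) e i * b i ^+ (p ^ (2 * s)) = 0.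
  move=> sn; under eq_bigr do rewrite /e mulrAC.
  by rewrite -mulr_suml cb ?mul0r.
have e_last : e n.+1 = 1 by rewrite /e divff.
have e2 i : (1 <= i <= n.+1)%N -> e i ^+ (p ^ 2) = e i.
  move=> /andP[i_gt0]; rewrite leq_eqVlt => /orP[/eqP ->|i_n].
    by rewrite e_last expr1n.
  apply/eqP; rewrite -subr_eq0; apply/eqP; move: i {i_gt0 i_n} (introT andP (conj i_gt0 i_n)).
  apply: (IH (fun i => b i ^+ (p ^ 2)) (fun i => e i ^+ (p ^ 2) - e i)).
    by apply: free_Fp2_pexp; apply: free_Fp2_leq b_free.
  move=> s sn; transitivity (\sum_(1 <= i < n.+2)
      (e i ^+ (p ^ 2) - e i) * (b i ^+ (p ^ 2)) ^+ (p ^ (2 * s))).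
    by rewrite [RHS]big_nat_recr //= e_last expr1n subrr mul0r addr0.
  under eq_bigr do rewrite mulrBl.
  rewrite sumrB [X in X - _](_ : _ = 0) ?[X in _ - X](_ : _ = 0) ?subrr //.
    by rewrite -[RHS](eb s.+1 sn); apply: eq_bigr => i _; rewrite -exprM -expnD mulnS.
  under eq_bigr do rewrite exprAC -exprMn.
  by rewrite -sum_expr_pchar eb ?(ltnW sn) // expr0_pexp.
have := b_free e e2; under eq_bigr do rewrite -[b _]expr1.
move/(_ (eb 0%N isT) n.+1); rewrite e_last leqnn => /(_ isT) /eqP.
by rewrite oner_eq0.
Qed.

Lemma moore_row_free n g (b : nat -> k) : (n <= g)%N -> free_Fp2 p n b ->
  row_free (\matrix_(s < n, i < g) b i.+1 ^+ (p ^ (2 * s))).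
Proof.
move=> ng b_free.
pose A := \matrix_(s < n, i < n) b i.+1 ^+ (p ^ (2 * s)).
have A_unit : A \in unitmx.
  rewrite -unitmx_tr -row_free_unit; apply: inj_row_free => c cA.
  pose c' i := if insub i.-1 is Some j then c 0 j else 0.
  have c'E (j : 'I_n) : c' j.+1 = c 0 j by rewrite /c' valK.
  apply/rowP => i; rewrite mxE -c'E; apply: (moore_kernel b_free); last exact: ltn_ord.
  move=> s sn; have /rowP/(_ (Ordinal sn)) := cA.
  rewrite !mxE big_add1 big_mkord => {2}<-; apply: eq_bigr => j _.
  by rewrite !mxE c'E.
apply: inj_row_free => l lM; rewrite -[l](mulmxK A_unit).
suff -> : l *m A = 0 by rewrite mul0mx.
apply/rowP => i; have /rowP/(_ (widen_ord ng i)) := lM; rewrite !mxE => {2}<-.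
by apply: eq_bigr => s _; rewrite !mxE.
Qed.

End Moore.

(** * The reduced form *)

Section Form.
Variable g : nat.

(** The exponent [n_i] in [X_i = Pi^(-n_i) e_i]. *)
Definition Xexp i : nat :=
  if (i.*2 < g.+1)%N then 0%N
  else if i.*2 == g.+1 then (g.-1)./2 else g.-1.

Lemma Xexp_rev i : (1 <= i <= g)%N -> (Xexp i + Xexp (g.+1 - i) = g.-1)%N.
Proof.
move=> /andP[i_gt0 ig]; rewrite /Xexp doubleB.
have := odd_double_half g.-1; have := leq_double i g.
case: ltngtP => h1; case: ltngtP => h2 /= h3 h4; try lia.
Qed.

Section Ring.
Variable R : comPzRingType.
Implicit Types (x y z : 'rV[R]_g) (f : nat -> R).

Definition rowv f : 'rV[R]_g := \row_i f i.+1.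

(** The Gram matrix of the [X_i] for < x, Pi^g y >. *)
Definition revform x y : R :=
  \sum_(i < g) (-1) ^+ Xexp i.+1 * x 0 i * y 0 (rev_ord i).

Lemma revformE f f' : revform (rowv f) (rowv f') =
  \sum_(1 <= i < g.+1) (-1) ^+ Xexp i * f i * f' (g.+1 - i)%N.
Proof.
rewrite big_add1 big_mkord; apply: eq_bigr => i _; rewrite !mxE /=.
by rewrite subSS subnSK.
Qed.

Lemma revformDl x y z : revform (x + y) z = revform x z + revform y z.
Proof.
by rewrite -big_split; apply: eq_bigr => i _; rewrite !mxE /= mulrDr mulrDl.
Qed.

Lemma revformDr x y z : revform x (y + z) = revform x y + revform x z.
Proof. by rewrite -big_split; apply: eq_bigr => i _; rewrite !mxE /= mulrDr. Qed.

Lemma revformZl c x y : revform (c *: x) y = c * revform x y.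
Proof.
by rewrite mulr_sumr; apply: eq_bigr => i _; rewrite !mxE mulrCA !mulrA.
Qed.

Lemma revformZr c x y : revform x (c *: y) = c * revform x y.
Proof. by rewrite mulr_sumr; apply: eq_bigr => i _; rewrite !mxE mulrCA. Qed.

Lemma revform_sym x y : revform y x = (-1) ^+ g.-1 * revform x y.
Proof.
rewrite /revform mulr_sumr (reindex_inj rev_ord_inj); apply: eq_bigr => i _ /=.
have -> : (-1) ^+ Xexp (g - i.+1).+1 = (-1) ^+ g.-1 * (-1) ^+ Xexp i.+1 :> R.
  rewrite -(@Xexp_rev i.+1) ?ltn_ord // exprD mulrAC -expr2 sqrr_sign mul1r.
  by rewrite subSS subnSK.
by rewrite rev_ordK; ring.
Qed.

(** Pairing off [i] with [g + 1 - i] makes the form alternating for even [g],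
    in every characteristic. *)
Lemma revform_alt x : ~~ odd g -> revform x x = 0.
Proof.
move=> g_even; rewrite /revform (bigID (fun i : 'I_g => (i < g./2)%N)) /=.
rewrite [X in _ + X](reindex_inj rev_ord_inj) /=.
rewrite [X in _ + X](eq_bigl (fun i : 'I_g => (i < g./2)%N)); last first.
  by move=> i; have := ltn_ord i; have := odd_double_half g;
     rewrite (negPf g_even) /= -leqNgt; lia.
rewrite -big_split big1 //= => i i_lt; rewrite rev_ordK.
have gE : (g./2.*2 = g)%N by have := odd_double_half g; rewrite (negPf g_even).
have -> : Xexp i.+1 = 0%N by rewrite /Xexp; case: ltnP => //; lia.
have -> : Xexp (g - i.+1).+1 = g.-1 by rewrite /Xexp; case: ltngtP; lia.
have g1_odd : odd g.-1 by lia.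
have -> : (-1) ^+ g.-1 = -1 :> R by rewrite -signr_odd g1_odd.
by rewrite expr0 mul1r mulN1r mulNr [x 0 i * _]mulrC subrr.
Qed.

Definition revform_mx : 'M[R]_g :=
  \matrix_(i, j) ((-1) ^+ Xexp i.+1 *+ (j == rev_ord i)).

Lemma revform_mxE x y : x *m revform_mx *m y^T = (revform x y)%:M.
Proof.
apply/matrixP => a b; rewrite !ord1 !mxE eqxx mulr1n /revform.
rewrite (reindex_inj rev_ord_inj) /=; apply: eq_bigr => i _; rewrite !mxE.
rewrite (bigD1 i) //= big1 ?addr0 => [|l li]; last first.
  rewrite !mxE [_ == rev_ord l](inj_eq rev_ord_inj) eq_sym (negPf li).
  by rewrite mulr0n mulr0.
by rewrite !mxE eqxx mulr1n [x _ _ * _]mulrC.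
Qed.

End Ring.

Lemma map_revform (R S : comPzRingType) (h : {rmorphism R -> S}) (x y : 'rV[R]_g) :
  h (revform x y) = revform (map_mx h x) (map_mx h y).
Proof.
rewrite /revform rmorph_sum; apply: eq_bigr => i _.
by rewrite !rmorphM rmorphXn rmorphN1 !mxE.
Qed.

(** Equality holds in the dimension bound for orthogonal subspaces, the form
    being non-degenerate. *)
Lemma orthogonal_span (k : fieldType) m n (A : 'M[k]_(m, g)) (B : 'M[k]_(n, g))
    (x : 'rV_g) :
  (m + n)%N = g -> row_free A -> row_free B ->
  (forall i j, revform (row i A) (row j B) = 0) ->
  (forall j, revform x (row j B) = 0) -> (x <= A)%MS.
Proof.
move=> mn A_free B_free AB xB.
have perp m' (C : 'M[k]_(m', g)) :
    (forall i j, revform (row i C) (row j B) = 0) -> C *m (revform_mx k *m B^T) = 0.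
  move=> CB; apply/matrixP => i j; rewrite mulmxA [RHS]mxE -(CB i j).
  have := revform_mxE (row i C) (row j B) => /matrixP/(_ 0 0).
  rewrite [RHS]mxE eqxx mulr1n => <-.
  by rewrite -row_mul !mxE; apply: eq_bigr => l _; rewrite !mxE.
have G_unit : revform_mx k \in unitmx.
  suff: revform_mx k *m (revform_mx k)^T = 1%:M by move/mulmx1_unit=> [].
  apply/matrixP => i j; rewrite !mxE (bigD1 (rev_ord i)) //= big1 ?addr0.
    rewrite !mxE eqxx mulr1n (inj_eq rev_ord_inj) eq_sym.
    by case: eqP => [->|_]; rewrite ?mulr0n ?mulr0 // mulr1n -expr2 sqrr_sign.
  by move=> l li; rewrite !mxE (negPf li) mulr0n mul0r.
pose H := revform_mx k *m B^T.
have rank_H : \rank H = n.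
  rewrite /H eqmxMfull ?row_full_unit // mxrank_tr.
  exact/eqP.
have : (A <= kermx H)%MS by apply/sub_kermxP/perp.
have x_ker : (x <= kermx H)%MS.
  apply/sub_kermxP/perp => i j; rewrite (_ : row i x = x) ?xB //.
  by apply/rowP => l; rewrite !mxE ord1.
move=> A_ker; rewrite (submx_trans x_ker) //.
rewrite -(geq_leqif (mxrank_leqif_sup A_ker)) mxrank_ker rank_H.
by move/eqP: A_free => ->; lia.
Qed.
End Form.

(** * The equations of level zero *)

Section System.
Context {p : nat} {k : fieldType} (p_char : p \in [pchar k]) (g : nat).
Hypothesis g_gt0 : (0 < g)%N.
Implicit Types (x y z : nat -> k) (a : nat -> nat -> k).

Notation frob_seq j x := (fun i => x i ^+ (p ^ j)).

Lemma revform_high_r x z : (forall i, (i <= uphalf g.+1)%N -> z i = 0) ->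
  revform (rowv g x) (rowv g z)
    = \sum_(1 <= i < (g.-1)./2.+1) x i * z (g.+1 - i)%N.
Proof.
move=> z0; rewrite revformE (big_cat_nat _ (n := (g.-1)./2.+1)) //=; last by lia.
rewrite [X in _ + X]big_nat [X in _ + X]big1 ?addr0; last first.
  by move=> i i_ge; rewrite z0 ?mulr0 //; lia.
rewrite big_nat [RHS]big_nat; apply: eq_bigr => i i_le.
by rewrite /Xexp (_ : (i.*2 < g.+1)%N) ?mul1r //; lia.
Qed.

Lemma revform_high_l x z : (forall i, (i <= uphalf g.+1)%N -> z i = 0) ->
  revform (rowv g z) (rowv g x)
    = (-1) ^+ g.-1 * \sum_(1 <= i < (g.-1)./2.+1) z (g.+1 - i)%N * x i.
Proof.
move=> z0; rewrite revform_sym revform_high_r //; congr (_ * _).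
by apply: eq_bigr => i _; rewrite mulrC.
Qed.

Lemma revform_high_high x z : (forall i, (i <= uphalf g.+1)%N -> x i = 0) ->
  (forall i, (i <= uphalf g.+1)%N -> z i = 0) ->
  revform (rowv g x) (rowv g z) = 0.
Proof.
move=> x0 z0; rewrite revform_high_r // big_nat big1 // => i i_le.
by rewrite x0 ?mul0r //; lia.
Qed.

Lemma revform_low_low a j : (forall i, (uphalf g.+1 < i)%N -> a i 0%N = 0) ->
  revform (rowv g (a^~ 0%N)) (rowv g (frob_seq j (a^~ 0%N))) = - d0 p g a j.
Proof.
move=> a0; rewrite revformE (big_cat_nat _ (n := (g.-1)./2.+1)) //=; last by lia.
rewrite [X in X + _]big_nat [X in X + _]big1 ?add0r; last first.
  by move=> i i_le; rewrite (a0 (g.+1 - i)%N) ?(expr0_pexp p_char) ?mulr0 //; lia.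
rewrite (big_cat_nat _ (n := (uphalf g.+1).+1)) //=; [|lia|lia].
rewrite [X in _ + X]big_nat [X in _ + X]big1 ?addr0; last first.
  by move=> i i_ge; rewrite a0 ?mulr0 ?mul0r //; lia.
rewrite /d0; have := odd_double_half g; case: ifP => g_odd /= gE.
  have -> : (g.-1)./2.+1 = (g./2).+1 by lia.
  have -> : uphalf g = (g./2).+1 by rewrite uphalf_half g_odd.
  rewrite big_nat1 /Xexp (_ : (g./2.+1.*2 < g.+1)%N = false); last by lia.
  rewrite (_ : g./2.+1.*2 == g.+1); last by lia.
  have -> : (g.-1)./2 = g./2 by lia.
  have -> : (g.+1 - (g./2).+1)%N = (g./2).+1 by lia.
  by rewrite exprS mulN1r !mulNr opprK.
have -> : (g.-1)./2.+1 = g./2 by lia.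
rewrite big_nat_recl // big_nat1 /Xexp (_ : (g./2.*2 < g.+1)%N); last by lia.
rewrite (_ : (g./2.+1.*2 < g.+1)%N = false); last by lia.
rewrite (_ : (g./2.+1.*2 == g.+1) = false); last by lia.
have g1_odd : odd g.-1 by lia.
have -> : (-1) ^+ g.-1 = -1 :> k by rewrite -signr_odd g1_odd.
have -> : (g.+1 - g./2)%N = (g./2).+1 by lia.
have -> : (g.+1 - (g./2).+1)%N = g./2 by lia.
by ring.
Qed.

Lemma revform_system_high x z a l j : (forall i, (i <= uphalf g.+1)%N -> z i = 0) ->
  (forall i, (uphalf g.+1 < i <= g)%N -> z i = a i l) ->
  (forall i, (1 <= i <= (g.-1)./2)%N -> x i = a i 0%N) ->
  revform (rowv g x) (rowv g (frob_seq j z))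
    + (-1) ^+ l * revform (rowv g z) (rowv g (frob_seq j x))
  = system_lhs p g ((-1) ^+ (g.-1 + l)) a l j.
Proof.
move=> z0 zE xE; rewrite revform_high_r; last first.
  by move=> i /z0 ->; rewrite (expr0_pexp p_char).
rewrite revform_high_l // !mulr_sumr -big_split big_nat /= /system_lhs [RHS]big_nat.
apply: eq_bigr => i i_le; rewrite xE; last by lia.
by rewrite zE ?exprD; [ring | lia].
Qed.

Lemma d0_ext a b j : (forall i, (1 <= i <= uphalf g.+1)%N -> a i 0%N = b i 0%N) ->
  d0 p g a j = d0 p g b j.
Proof.
move=> ab; rewrite /d0; have := odd_double_half g; case: ifP => _ /= gE.
  by rewrite ab //=; lia.
by rewrite !ab //=; lia.
Qed.

Lemma revform_system a j :
  revform (rowv g (a^~ 0%N)) (rowv g (frob_seq j (a^~ 0%N)))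
    = system_lhs p g ((-1) ^+ g.-1) a 0 j - d0 p g a j.
Proof.
pose lo i (_ : nat) := if (i <= uphalf g.+1)%N then a i 0%N else 0.
pose z i := if (i <= uphalf g.+1)%N then 0 else a i 0%N.
have loz : rowv g (a^~ 0%N) = rowv g (lo^~ 0%N) + rowv g z.
  by apply/rowP => i; rewrite !mxE /lo /z; case: ifP; rewrite ?addr0 ?add0r.
have lozp : rowv g (frob_seq j (a^~ 0%N))
    = rowv g (frob_seq j (lo^~ 0%N)) + rowv g (frob_seq j z).
  apply/rowP => i; rewrite !mxE /lo /z.
  by case: ifP; rewrite (expr0_pexp p_char) ?addr0 ?add0r.
have z0 i : (i <= uphalf g.+1)%N -> z i = 0 by rewrite /z => ->.
rewrite loz lozp revformDl !revformDr revform_low_low; last first.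
  by move=> i i_gt; rewrite /lo leqNgt i_gt.
rewrite (revform_high_high (x := z) (z := frob_seq j z)) ?addr0 //; last first.
  by move=> i /z0 ->; apply: expr0_pexp p_char _.
have <- : d0 p g lo j = d0 p g a j.
  by apply: d0_ext => i /andP[_ i_le]; rewrite /lo i_le.
rewrite -[in RHS](addn0 g.-1) -(revform_system_high (x := lo^~ 0%N) (z := z)) //=.
- by rewrite expr0 mul1r; ring.
- by move=> i /andP[i_gt _]; rewrite /z leqNgt i_gt.
by move=> i i_le; rewrite /lo ifT //; lia.
Qed.

Lemma sign_pexp j n : ((-1) ^+ n) ^+ (p ^ j) = (-1) ^+ n :> k.
Proof.
rewrite exprAC; congr (_ ^+ _); elim: j => [|j IH]; first by rewrite expr1.
by rewrite expnSr exprM IH -(pFrobenius_autE p_char) pFrobenius_autN pFrobenius_aut1.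
Qed.

Lemma revform_pexp j x y :
  revform (rowv g (frob_seq j x)) (rowv g (frob_seq j y))
    = revform (rowv g x) (rowv g y) ^+ (p ^ j).
Proof.
rewrite !revformE (sum_expr_pchar p_char); apply: eq_bigr => i _.
by rewrite !exprMn sign_pexp.
Qed.

(** By the equations of level zero the vectors [sigma^(2s) a] with
    [s < ceil(g/2)] are orthogonal to [floor(g/2)] vectors of the same kind,
    shifted by one [sigma] when [g] is odd.  A vector over F_{p^2} orthogonal to
    all of the former is therefore a combination of the latter; being fixed by
    [sigma^2], it vanishes, as one more twist still gives independent vectors. *)
Lemma free_all a : leading_free p g a -> system0 p g a ->
  free_Fp2 p g (a^~ 0%N).
Proof.
move=> a_free a_sys c c2 ca i i_g.
pose b j := rowv g (frob_seq j (a^~ 0%N)).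
(* apply sigma^i1 to the equations *)
have b_far i1 j1 : (j1 < g.-1)%N -> odd (j1 + g) = false -> (0 < j1)%N ->
    revform (b i1) (b (i1 + j1)%N) = 0.
  move=> j1_lt j1_odd j1_gt0.
  have -> : b (i1 + j1)%N = rowv g (frob_seq i1 (frob_seq j1 (a^~ 0%N))).
    by apply/rowP => l; rewrite !mxE -exprM -expnD addnC.
  rewrite revform_pexp revform_system a_sys ?subrr ?(expr0_pexp p_char) //.
  rewrite /level_range j1_gt0 subn0 j1_lt addn0 !modn2 /=; lia.
have b_orth i1 j1 : (i1 < j1 + g.-1)%N -> (j1 < i1 + g.-1)%N ->
    odd (i1 + j1) = odd g -> revform (b i1) (b j1) = 0.
  move=> ij ji ij_odd; case: (ltngtP i1 j1) => [lt_ij|lt_ji|eq_ij].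
  - by rewrite -(subnKC (ltnW lt_ij)) b_far //; lia.
  - by rewrite revform_sym -(subnKC (ltnW lt_ji)) b_far ?mulr0 //; lia.
  by rewrite eq_ij revform_alt //; lia.
pose h := g./2; have gE := odd_double_half g.
pose A := \matrix_(s < h, i < g) (a i.+1 0%N ^+ (p ^ odd g)) ^+ (p ^ (2 * s)).
pose B := \matrix_(s < uphalf g, i < g) a i.+1 0%N ^+ (p ^ (2 * s)).
have ceilE : uphalf g.+1 = h.+1 by [].
have A_row s : row s A = b (odd g + 2 * s)%N.
  by apply/rowP => l; rewrite !mxE -exprM -expnD.
have B_row s : row s B = b (2 * s)%N by apply/rowP => l; rewrite !mxE.
have uh : uphalf g = (odd g + h)%N by rewrite uphalf_half.
have a_free' n : (n <= h.+1)%N -> free_Fp2 p n (a^~ 0%N).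
  by move=> n_le; apply: free_Fp2_leq a_free.
have hg : (h <= g)%N by lia.
(* c, transported to a vector orthogonal to every sigma^(2s) a *)
pose c' i : k := (-1) ^+ Xexp g i * c (g.+1 - i)%N.
have c'_orth s : revform (rowv g c') (b (2 * s)%N) = 0.
  rewrite revformE -[RHS](expr0_pexp p_char (2 * s)) -[in RHS]ca (sum_expr_pchar p_char).
  rewrite [RHS]big_nat_rev /= big_nat [RHS]big_nat; apply: eq_bigr => j j_g.
  rewrite mulrA -expr2 sqrr_sign mul1r add1n subSS exprMn; congr (_ * _).
  have c_pow q : c (g.+1 - j)%N ^+ (p ^ (2 * q)) = c (g.+1 - j)%N.
    by elim: q => // q IH; rewrite mulnS expnD exprM c2 //; lia.
  by rewrite c_pow.
have : (rowv g c' <= A)%MS.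
  apply: (orthogonal_span (B := B)) => [||||s].
  - by rewrite uh; lia.
  - have alpha_free := free_Fp2_pexp p_char (m := odd g) (a_free' h (leqnSn h)).
    exact: (moore_row_free p_char hg alpha_free).
  - by apply: (moore_row_free p_char (b := a^~ 0%N)); [lia | apply: a_free'; lia].
  - move=> s t; have s_lt := ltn_ord s; have t_lt := ltn_ord t.
    by rewrite A_row B_row b_orth //; lia.
  by rewrite B_row c'_orth.
case/submxP => u c'E.
pose U s := if insub s is Some s' then u 0 s' else 0.
have UE (s : 'I_h) : U s = u 0 s by rewrite /U valK.
have U_h : U h = 0 by rewrite /U insubF ?ltnn.
pose alpha (l : 'I_g) := a l.+1 0%N ^+ (p ^ odd g).
have c'U (l : 'I_g) : c' l.+1 = \sum_(s < h) U s * alpha l ^+ (p ^ (2 * s)).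
  have /rowP/(_ l) := c'E; rewrite !mxE => ->.
  by apply: eq_bigr => s _; rewrite UE !mxE.
have c'2 (l : 'I_g) : c' l.+1 ^+ (p ^ 2) = c' l.+1.
  rewrite /c' exprMn c2 ?subSS; last by have := ltn_ord l; lia.
  by rewrite sign_pexp.
pose w := \row_(s < h.+1) ((if s : nat is s'.+1 then U s' ^+ (p ^ 2) else 0) - U s).
have w0 : w = 0.
  pose A' := \matrix_(s < h.+1, l < g) alpha l ^+ (p ^ (2 * s)).
  have A'_free : row_free A'.
    have alpha_free := free_Fp2_pexp p_char (m := odd g) (a_free' h.+1 (leqnn _)).
    by apply: (moore_row_free p_char _ alpha_free); lia.
  apply: (row_free_inj A'_free); rewrite mul0mx; apply/rowP => l; rewrite !mxE.
  under eq_bigr do rewrite !mxE mulrBl.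
  rewrite sumrB big_ord_recl mul0r add0r [X in _ - X]big_ord_recr /= U_h mul0r addr0.
  rewrite -c'U -[X in _ - X]c'2 c'U (sum_expr_pchar p_char) -sumrB big1 // => s _.
  by rewrite exprMn -[in X in _ - X]exprM -expnD add0n mulnS [(2 + _)%N]addnC subrr.
have U0 s : (s < h.+1)%N -> U s = 0.
  elim: s => [|s IH] s_h; have /rowP/(_ (Ordinal s_h)) := w0; rewrite !mxE /=.
    by rewrite sub0r => /eqP; rewrite oppr_eq0 => /eqP.
  by rewrite IH ?(ltnW s_h) // (expr0_pexp p_char) sub0r => /eqP; rewrite oppr_eq0 => /eqP.
have c'0 j : (1 <= j <= g)%N -> c' j = 0.
  case: j => // j /= j_g; rewrite (c'U (Ordinal j_g)) big1 // => s _.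
  by rewrite U0 ?mul0r // ltnW // ltnS ltn_ord.
have i'_g : (1 <= g.+1 - i <= g)%N by lia.
have /eqP := c'0 _ i'_g.
rewrite /c' mulf_eq0 signr_eq0 /= subKn; last by lia.
by move/eqP.
Qed.
End System.

(** * The isocrystal in the coordinates of the X_i *)

Section Operators.
Context {p : nat} {k : fieldType} (W : witt_ring p k).
Notation K := {fraction witt_carrier W}.

Lemma fracP (x : K) :
  exists a b : W, b != 0 /\ x = tofrac a / tofrac b.
Proof.
exists (frac (repr x)).1, (frac (repr x)).2.
by split; [exact: denom_ratioP | exact: frac_numden].
Qed.

Let frob_inj : injective (frob W).
Proof. exact: can_inj (@frobK p k W). Qed.

Let frob_neq0 (b : W) : b != 0 -> tofrac (frob W b) != 0.
Proof. by rewrite tofrac_eq0 -(inj_eq frob_inj) rmorph0. Qed.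

Let sigma_additive : zmod_morphism (sigma (W := W)).
Proof.
move=> x y; have [a [b [b0 ->]]] := fracP x; have [c [d [d0 ->]]] := fracP y.
rewrite -mulNr -tofracN addf_div ?tofrac_eq0 // -!tofracM -tofracD.
rewrite /sigma !frac_mapE ?mulf_neq0 // -mulNr -tofracN addf_div ?frob_neq0 //.
by rewrite -!tofracM -tofracD rmorphD !rmorphM rmorphN.
Qed.

Let sigma_multiplicative : monoid_morphism (sigma (W := W)).
Proof.
split=> [|x y].
  have := frac_mapE 1 frob_inj (oner_neq0 W).
  by rewrite !rmorph1 divr1.
have [a [b [b0 ->]]] := fracP x; have [c [d [d0 ->]]] := fracP y.
rewrite mulf_div -!tofracM /sigma !frac_mapE ?mulf_neq0 //.
by rewrite mulf_div -!tofracM !rmorphM.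
Qed.

HB.instance Definition _ :=
  GRing.isZmodMorphism.Build K K (sigma (W := W)) sigma_additive.
HB.instance Definition _ :=
  GRing.isMonoidMorphism.Build K K (sigma (W := W)) sigma_multiplicative.

Lemma sigma_tofrac (x : W) :
  sigma (tofrac x) = tofrac (frob W x).
Proof.
have := frac_mapE x frob_inj (oner_neq0 W).
by rewrite !rmorph1 !divr1.
Qed.

Lemma tofrac_p : tofrac (p%:R : W) = p%:R.
Proof. by rewrite rmorph_nat. Qed.

Lemma tofrac_inj : injective (@tofrac W).
Proof. by move=> x y /eqP; rewrite tofrac_eq => /eqP. Qed.

End Operators.

Section Coordinates.
Context {p : nat} {k : fieldType} (W : witt_ring p k) (g : nat).
Notation K := {fraction witt_carrier W}.
Notation N := (Nspace W g).
Implicit Types (x y z : N) (c : K).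

Lemma PiD x y : Pi (x + y) = Pi x + Pi y.
Proof. by congr pair; rewrite /= scalerDr. Qed.

Lemma PiZ c x : Pi (c *: x) = c *: Pi x.
Proof. by congr pair; rewrite /= !scalerA mulrC. Qed.

Lemma Pi_Pi x : Pi (Pi x) = p%:R *: x.
Proof. by []. Qed.

Lemma iter_PiD n x y : iter n Pi (x + y) = iter n Pi x + iter n Pi y.
Proof. by elim: n => //= n ->; rewrite PiD. Qed.

Lemma iter_PiZ n c x : iter n Pi (c *: x) = c *: iter n Pi x.
Proof. by elim: n => //= n ->; rewrite PiZ. Qed.

Lemma iter_Pi0 n : iter n Pi (0 : N) = 0.
Proof. by have := iter_PiZ n 0 0; rewrite !scale0r. Qed.

Lemma iter_Pi_sum n (I : Type) (r : seq I) (P : pred I) (F : I -> N) :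
  iter n Pi (\sum_(i <- r | P i) F i) = \sum_(i <- r | P i) iter n Pi (F i).
Proof. exact: (big_morph _ (iter_PiD n) (iter_Pi0 n)). Qed.

Lemma iter_Pi_double n x : iter n.*2 Pi x = p%:R ^+ n *: x.
Proof.
elim: n => [|n IH]; first by rewrite scale1r.
by rewrite doubleS !iterS IH Pi_Pi scalerA -exprS.
Qed.

Lemma iter_PiK n x : iter n Piinv (iter n Pi x) = x.
Proof. by elim: n => // n IH; rewrite iterSr iterS PiK. Qed.

Lemma iter_PiinvK n x : iter n Pi (iter n Piinv x) = x.
Proof. by elim: n => // n IH; rewrite iterSr iterS PiinvK. Qed.

Lemma FmapD x y : Fmap (x + y) = Fmap x + Fmap y.
Proof. by congr pair; rewrite /= map_mxD ?scalerDr. Qed.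

Lemma FmapZ c x : Fmap (c *: x) = sigma c *: Fmap x.
Proof. by congr pair; rewrite /= map_mxZ // !scalerA mulrC. Qed.

Lemma Fmap0 : Fmap (0 : N) = 0.
Proof. by have := FmapZ 0 0; rewrite rmorph0 !scale0r. Qed.

Lemma Fmap_Pi x : Fmap (Pi x) = Pi (Fmap x).
Proof. by congr pair; rewrite /= map_mxZ rmorph_nat. Qed.

Lemma Fmap_Piinv x : Fmap (Piinv x) = Piinv (Fmap x).
Proof. by rewrite -[LHS]PiK -Fmap_Pi PiinvK. Qed.

Lemma Fmap_Vmap x : Fmap (Vmap x) = p%:R *: x.
Proof. by rewrite /Vmap FmapZ FinvK rmorph_nat. Qed.

Lemma Vmap_Fmap x : Vmap (Fmap x) = p%:R *: x.
Proof. by rewrite /Vmap FmapK. Qed.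

(** ** The pairing *)

Lemma pairingDl x y z : pairing (x + y) z = pairing x z + pairing y z.
Proof. by rewrite -big_split; apply: eq_bigr => i _; rewrite !mxE /=; ring. Qed.

Lemma pairingZl c x y : pairing (c *: x) y = c * pairing x y.
Proof. by rewrite mulr_sumr; apply: eq_bigr => i _; rewrite !mxE /=; ring. Qed.

Lemma pairing_anti x y : pairing y x = - pairing x y.
Proof.
rewrite /pairing (reindex_inj rev_ord_inj) -sumrN; apply: eq_bigr => i _.
by rewrite rev_ordK; ring.
Qed.

Lemma pairing_alt x : pairing x x = 0.
Proof.
rewrite /pairing sumrB [X in _ - X](reindex_inj rev_ord_inj) -sumrB big1 //= => i _.
by rewrite rev_ordK mulrC subrr.
Qed.

Lemma pairingDr x y z : pairing z (x + y) = pairing z x + pairing z y.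
Proof. by rewrite !(pairing_anti _ z) pairingDl opprD. Qed.

Lemma pairingZr c x y : pairing y (c *: x) = c * pairing y x.
Proof. by rewrite !(pairing_anti _ y) pairingZl mulrN. Qed.

Lemma pairing0l x : pairing 0 x = 0.
Proof. by rewrite -(scale0r 0) pairingZl mul0r. Qed.

Lemma pairing0r x : pairing x 0 = 0.
Proof. by rewrite pairing_anti pairing0l oppr0. Qed.

Lemma pairing_suml (I : Type) (r : seq I) (P : pred I) (F : I -> N) x :
  pairing (\sum_(i <- r | P i) F i) x = \sum_(i <- r | P i) pairing (F i) x.
Proof. exact: (big_morph _ (fun u v => pairingDl u v x) (pairing0l x)). Qed.

Lemma pairing_sumr (I : Type) (r : seq I) (P : pred I) (F : I -> N) x :
  pairing x (\sum_(i <- r | P i) F i) = \sum_(i <- r | P i) pairing x (F i).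
Proof. exact: (big_morph _ (fun u v => pairingDr u v x) (pairing0r x)). Qed.

Lemma pairing_Pi x y : pairing (Pi x) y = - pairing x (Pi y).
Proof. by rewrite -sumrN; apply: eq_bigr => i _; rewrite !mxE /=; ring. Qed.

Lemma pairing_iter_Pi n x y :
  pairing (iter n Pi x) y = (-1) ^+ n * pairing x (iter n Pi y).
Proof.
elim: n y => [|n IH] y; first by rewrite mul1r.
by rewrite iterS pairing_Pi IH -iterSr exprS mulN1r mulNr.
Qed.

Lemma pairing_iter_Piinv n x y :
  pairing (iter n Piinv x) y = (-1) ^+ n * pairing x (iter n Piinv y).
Proof.
by rewrite -{1}[y](iter_PiinvK n) -[pairing (iter n Piinv x) _]mul1r
  -{1}(sqrr_sign K n) expr2 -mulrA -pairing_iter_Pi iter_PiinvK.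
Qed.

Lemma pairing_Fmap x y : pairing (Fmap x) y = - sigma (pairing x (Vmap y)).
Proof.
rewrite -[y in LHS](FinvK) /Vmap pairingZr rmorphM rmorph_nat.
rewrite /pairing rmorph_sum mulr_sumr -sumrN; apply: eq_bigr => i _.
by rewrite !mxE /= rmorphB !rmorphM /=; ring.
Qed.

(** ** The Gram matrix of the X_i *)

Lemma XvecE i : Xvec W g i = iter (Xexp g i) Piinv (basis_e W g i).
Proof. by rewrite /Xvec /Xexp; case: ifP => // _; case: ifP. Qed.

Let on_line i x := exists c d : K, x = c *: basis_e W g i + d *: basis_f W g i.

Lemma line_Pi i x : on_line i x -> on_line i (Pi x).
Proof.
move=> [c [d ->]]; exists (p%:R * d), c.
by congr pair; apply/rowP => l; rewrite !mxE /=; ring.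
Qed.

Lemma line_Piinv i x : on_line i x -> on_line i (Piinv x).
Proof.
move=> [c [d ->]]; exists d, (p%:R^-1 * c).
by congr pair; apply/rowP => l; rewrite !mxE /=; ring.
Qed.

Lemma line_iter i m n : on_line i (iter m Pi (iter n Piinv (basis_e W g i))).
Proof.
elim: m => [|m]; last exact: line_Pi.
elim: n => [|n]; last exact: line_Piinv.
by exists 1, 0; rewrite scale1r scale0r addr0.
Qed.

Lemma pairing_line (i j : 'I_g) x y : j != rev_ord i ->
  on_line i.+1 x -> on_line j.+1 y -> pairing x y = 0.
Proof.
move=> ji [c [d ->]] [c' [d' ->]]; rewrite /pairing big1 // => l _.
rewrite !mxE !eqSS /= !mulr0 !addr0 !add0r.
case: (eqVneq l i) => [->|li]; last first.
  by rewrite (negPf (li : (l != i :> nat))) !mulr0 !mul0r subrr.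
rewrite (_ : (g - i.+1 == j)%N = false) ?mulr0 ?subrr //.
by rewrite eq_sym; apply: negPf ji.
Qed.

Lemma pairing_Xvec_neq i j m : (1 <= i <= g)%N -> (1 <= j <= g)%N ->
  j != (g.+1 - i)%N -> pairing (Xvec W g i) (iter m Pi (Xvec W g j)) = 0.
Proof.
case: i j => // i [] // j /= i_g j_g ji; rewrite !XvecE.
apply: (@pairing_line (Ordinal i_g) (Ordinal j_g)); last exact: line_iter.
  by apply: contra ji => /eqP/(congr1 val) /= ->; rewrite subSS subnSK.
exact: (line_iter _ 0).
Qed.

Lemma pairing_basis_e (i : 'I_g) :
  pairing (basis_e W g i.+1) (Pi (basis_e W g (rev_ord i).+1)) = 1.
Proof.
rewrite /pairing (bigD1 i) //= big1 => [|l li]; last first.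
  by rewrite !mxE eqSS (negPf (li : (l != i :> nat))) !mul0r subrr.
by rewrite !mxE !eqxx mul0r subr0 mulr1 addr0.
Qed.

Lemma pairing_basis_e0 i j : pairing (basis_e W g i) (basis_e W g j) = 0.
Proof. by rewrite /pairing big1 // => l _; rewrite !mxE mulr0 mul0r subrr. Qed.

Lemma Xexp_cancel (i : 'I_g) m n x : n = (g + m)%N ->
  iter (Xexp g i.+1) Piinv (iter n Pi (iter (Xexp g (rev_ord i).+1) Piinv x))
    = iter m.+1 Pi x.
Proof.
move=> ->; have E := @Xexp_rev g i.+1 (ltn_ord i); rewrite subSS -subnSK // in E.
have -> : (g + m = Xexp g i.+1 + m.+1 + Xexp g (rev_ord i).+1)%N.
  by rewrite /= addnAC E; have := ltn_ord i; lia.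
by rewrite addnAC !iterD iter_PiK -iterD addnC iterD iter_PiinvK.
Qed.

(** With [X_i = Pi^(-n_i) e_i] and [n_i + n_{g+1-i} = g - 1], the pairing
    < X_i, Pi^g X_{g+1-i} > is < e_i, f_{g+1-i} > up to the sign of moving
    [Pi^(-n_i)] across. *)
Lemma pairing_Xvec (i j : 'I_g) :
  pairing (Xvec W g i.+1) (iter g Pi (Xvec W g j.+1))
    = (-1) ^+ Xexp g i.+1 *+ (j == rev_ord i).
Proof.
rewrite !XvecE; case: (eqVneq j (rev_ord i)) => [->|ji]; last first.
  by apply: pairing_line ji _ _; [apply: (line_iter _ 0)|apply: line_iter].
rewrite pairing_iter_Piinv (@Xexp_cancel i 0) ?addn0 //.
by rewrite /= pairing_basis_e mulr1.
Qed.

Lemma pairing_Xvec0 (i j : 'I_g) :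
  pairing (Xvec W g i.+1) (iter g.+1 Pi (Xvec W g j.+1)) = 0.
Proof.
rewrite !XvecE; case: (eqVneq j (rev_ord i)) => [->|ji]; last first.
  by apply: pairing_line ji _ _; [apply: (line_iter _ 0)|apply: line_iter].
rewrite pairing_iter_Piinv (@Xexp_cancel i 1) ?addn1 //.
by rewrite /= Pi_Pi pairingZr pairing_basis_e0 !mulr0.
Qed.

(** ** Coordinates *)

Definition Xcomb (c d : 'rV[K]_g) : N :=
  \sum_(i < g) (c 0 i *: Xvec W g i.+1 + d 0 i *: Pi (Xvec W g i.+1)).

Lemma pairing_Xcomb (c d c' d' : 'rV[K]_g) : pairing (Xcomb c d) (iter g Pi (Xcomb c' d'))
  = revform c c' - p%:R * revform d d'.
Proof.
rewrite pairing_suml /revform mulr_sumr -sumrB; apply: eq_bigr => i _.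
rewrite iter_Pi_sum pairing_sumr.
have E j : pairing (c 0 i *: Xvec W g i.+1 + d 0 i *: Pi (Xvec W g i.+1))
    (iter g Pi (c' 0 j *: Xvec W g j.+1 + d' 0 j *: Pi (Xvec W g j.+1)))
    = (c 0 i * c' 0 j - p%:R * (d 0 i * d' 0 j))
        * pairing (Xvec W g i.+1) (iter g Pi (Xvec W g j.+1)).
  rewrite iter_PiD !iter_PiZ -iterSr !pairingDl !pairingDr !pairingZl !pairingZr.
  rewrite !pairing_Pi -!iterS pairing_Xvec0 2!iterS Pi_Pi pairingZr.
  by ring.
under eq_bigr do rewrite E pairing_Xvec.
rewrite (bigD1 (rev_ord i)) //= big1 ?addr0 => [|j ji]; last first.
  by rewrite (negPf ji) mulr0.
by rewrite eqxx mulr1n; ring.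
Qed.

Lemma Pi_Xcomb (c d : 'rV[K]_g) : Pi (Xcomb c d) = Xcomb (p%:R *: d) c.
Proof.
rewrite -[LHS]/(iter 1 Pi _) iter_Pi_sum; apply: eq_bigr => i _.
by rewrite iter_PiD !iter_PiZ /= Pi_Pi scalerA addrC !mxE mulrC.
Qed.

End Coordinates.

(** * The lattice Lambda_0 *)

Section Lattice.
Context {p : nat} {k : fieldType} (W : witt_ring p k) (p_prime : prime p) (g : nat).
Notation K := {fraction witt_carrier W}.
Notation N := (Nspace W g).

(** [(c, d)] stands for [\sum_i (c_i X_i + d_i Pi X_i)]; in these coordinates
    [F] is [Pi sigma] and [V] is [Pi sigma^-1]. *)
Definition lat := ('rV[witt_carrier W]_g * 'rV[witt_carrier W]_g)%type.

Implicit Types (x y z : lat) (c : W).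

Definition emb x : N := Xcomb (map_mx (@tofrac W) x.1) (map_mx (@tofrac W) x.2).
Definition latPi x : lat := (p%:R *: x.2, x.1).
Definition lat_frob x : lat := (map_mx (frob W) x.1, map_mx (frob W) x.2).
Definition lat_frobV x : lat := (map_mx (frobV W) x.1, map_mx (frobV W) x.2).
Definition residue x : 'rV[k]_g := map_mx (red W) x.1.
Definition teichv (u : 'rV[k]_g) : lat := (map_mx (teich W) u, 0).

Lemma embD x y : emb (x + y) = emb x + emb y.
Proof.
rewrite /emb /Xcomb -big_split; apply: eq_bigr => i _ /=.
by rewrite !mxE !tofracD !scalerDl addrACA.
Qed.

Lemma embZ c x : emb (c *: x) = tofrac c *: emb x.
Proof.
rewrite /emb /Xcomb scaler_sumr; apply: eq_bigr => i _ /=.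
by rewrite !mxE !tofracM scalerDr !scalerA.
Qed.

Lemma emb0 : emb 0 = 0.
Proof. by rewrite -(scale0r 0) embZ tofrac0 scale0r. Qed.

Lemma embB x y : emb (x - y) = emb x - emb y.
Proof. by rewrite embD -scaleN1r embZ tofracN tofrac1 scaleN1r. Qed.

Lemma emb_sum (I : Type) (r : seq I) (P : pred I) (F : I -> lat) :
  emb (\sum_(i <- r | P i) F i) = \sum_(i <- r | P i) emb (F i).
Proof. exact: (big_morph _ embD emb0). Qed.

Lemma emb_Pi x : emb (latPi x) = Pi (emb x).
Proof.
by rewrite Pi_Xcomb /emb /= map_mxZ rmorph_nat.
Qed.

Lemma Fmap_Xvec i : Fmap (Xvec W g i) = Pi (Xvec W g i).
Proof.
rewrite XvecE; elim: (Xexp g i) => [|n IH].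
  by congr pair; apply/rowP => j; rewrite !mxE /= ?rmorph0 ?rmorph_nat.
by rewrite iterS Fmap_Piinv IH PiK PiinvK.
Qed.

Lemma emb_F x : emb (latPi (lat_frob x)) = Fmap (emb x).
Proof.
rewrite emb_Pi /emb /Xcomb (big_morph Fmap (@FmapD _ _ W g) (@Fmap0 _ _ W g)).
rewrite -[LHS]/(iter 1 Pi _) iter_Pi_sum; apply: eq_bigr => i _.
rewrite iter_PiD !iter_PiZ FmapD !FmapZ Fmap_Pi Fmap_Xvec /= !mxE.
by rewrite !sigma_tofrac.
Qed.

Lemma latPiD x y : latPi (x + y) = latPi x + latPi y.
Proof. by congr pair; rewrite /= scalerDr. Qed.

Lemma latPiZ c x : latPi (c *: x) = c *: latPi x.
Proof. by congr pair; rewrite /= !scalerA mulrC. Qed.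

Lemma latPi_Pi x : latPi (latPi x) = p%:R *: x.
Proof. by []. Qed.

Lemma latPi_inj : injective latPi.
Proof.
move=> [c d] [c' d'] [/rowP dd ->]; congr pair; apply/rowP => i.
by have := dd i; rewrite !mxE; apply: mulfI; apply: witt_p_neq0.
Qed.

Lemma iter_latPiD n x y : iter n latPi (x + y) = iter n latPi x + iter n latPi y.
Proof. by elim: n => //= n ->; rewrite latPiD. Qed.

Lemma iter_latPiZ n c x : iter n latPi (c *: x) = c *: iter n latPi x.
Proof. by elim: n => //= n ->; rewrite latPiZ. Qed.

Lemma iter_latPi0 n : iter n latPi 0 = 0.
Proof. by have := iter_latPiZ n 0 0; rewrite !scale0r. Qed.

Lemma iter_latPi_sum n (I : Type) (r : seq I) (P : pred I) (F : I -> lat) :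
  iter n latPi (\sum_(i <- r | P i) F i) = \sum_(i <- r | P i) iter n latPi (F i).
Proof. exact: (big_morph _ (iter_latPiD n) (iter_latPi0 n)). Qed.

Lemma iter_latPi_inj n : injective (iter n latPi).
Proof. by elim: n => // n IH x y /latPi_inj/IH. Qed.

Lemma iter_latPi_double n x : iter n.*2 latPi x = p%:R ^+ n *: x.
Proof.
elim: n => [|n IH]; first by rewrite scale1r.
by rewrite doubleS !iterS IH latPi_Pi scalerA -exprS.
Qed.

Lemma emb_iter_Pi n x : emb (iter n latPi x) = iter n Pi (emb x).
Proof. by elim: n => //= n <-; rewrite emb_Pi. Qed.

Lemma lat_frobD x y : lat_frob (x + y) = lat_frob x + lat_frob y.
Proof. by congr pair; rewrite /= map_mxD. Qed.

Lemma lat_frobZ c x : lat_frob (c *: x) = frob W c *: lat_frob x.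
Proof. by congr pair; rewrite /= map_mxZ. Qed.

Lemma lat_frob_Pi x : lat_frob (latPi x) = latPi (lat_frob x).
Proof. by congr pair; rewrite /= map_mxZ rmorph_nat. Qed.

Lemma lat_frobK : cancel lat_frob lat_frobV.
Proof. by case=> c d; congr pair; apply/rowP => i; rewrite !mxE frobK. Qed.

Lemma lat_frobVK : cancel lat_frobV lat_frob.
Proof. by case=> c d; congr pair; apply/rowP => i; rewrite !mxE frobVK. Qed.

Lemma lat_frobV_Pi x : lat_frobV (latPi x) = latPi (lat_frobV x).
Proof. by apply: (can_inj lat_frobK); rewrite lat_frobVK lat_frob_Pi lat_frobVK. Qed.

Lemma lat_frob_iter_Pi n x : lat_frob (iter n latPi x) = iter n latPi (lat_frob x).
Proof. by elim: n => //= n IH; rewrite lat_frob_Pi IH. Qed.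

Lemma lat_frobV_iter_Pi n x : lat_frobV (iter n latPi x) = iter n latPi (lat_frobV x).
Proof. by elim: n => //= n IH; rewrite lat_frobV_Pi IH. Qed.

Lemma emb_V x : emb (latPi (lat_frobV x)) = Vmap (emb x).
Proof.
apply: (can_inj (@FmapK p k W g)); rewrite -emb_F lat_frob_Pi lat_frobVK latPi_Pi.
by rewrite embZ tofrac_p Fmap_Vmap.
Qed.

Lemma emb_tau x : taumap (emb x) = emb (lat_frob (lat_frob x)).
Proof.
rewrite /taumap -!emb_F lat_frob_Pi latPi_Pi embZ tofrac_p scalerA.
by rewrite mulVf ?frac_p_neq0 ?scale1r.
Qed.

Lemma emb_iter_F n x : iter n Fmap (emb x) = emb (iter n latPi (iter n lat_frob x)).
Proof.
elim: n => [|n IH]; first by [].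
by rewrite iterS IH -emb_F lat_frob_iter_Pi [iter n.+1 lat_frob x]iterS [in RHS]iterS.
Qed.

Lemma emb_iter_V n x : iter n Vmap (emb x) = emb (iter n latPi (iter n lat_frobV x)).
Proof.
elim: n => [|n IH]; first by [].
by rewrite iterS IH -emb_V lat_frobV_iter_Pi [iter n.+1 lat_frobV x]iterS [in RHS]iterS.
Qed.

(** ** The integral form *)

(** The exponent [g] makes < x, Pi^g y > independent of the parity of [g] and
    perfect modulo [Pi]. *)
Definition hform x y : W := revform x.1 y.1 - p%:R * revform x.2 y.2.

Lemma pairing_emb x y : pairing (emb x) (iter g Pi (emb y)) = tofrac (hform x y).
Proof.
by rewrite pairing_Xcomb -!map_revform /hform tofracD tofracN tofracM tofrac_p.
Qed.

Lemma hform_Pir x y : exists c, hform x (latPi y) = p%:R * c.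
Proof.
exists (revform x.1 y.2 - revform x.2 y.1).
by rewrite /hform /= revformZr; ring.
Qed.

Lemma red_hform x y : red W (hform x y) = revform (residue x) (residue y).
Proof. by rewrite /hform rmorphB rmorphM red_p mul0r subr0 map_revform. Qed.

Lemma Lambda0_emb v : Lambda0 W g v <-> exists x, v = emb x.
Proof.
split=> [[c [d ->]]|[x ->]].
  exists (rowv g c, rowv g d); rewrite /emb /Xcomb big_add1 big_mkord.
  by apply: eq_bigr => i _; rewrite !mxE.
pose f (u : 'rV[W]_g) n := if insub n.-1 is Some i then u 0 i else 0.
exists (f x.1), (f x.2); rewrite /emb /Xcomb big_add1 big_mkord.
by apply: eq_bigr => i _; rewrite !mxE /f /= !valK.
Qed.

Lemma Xcomb_surj (v : N) : exists c d : 'rV[K]_g, v = Xcomb c d.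
Proof.
pose S v := exists c d : 'rV[K]_g, v = Xcomb c d.
have SD u w : S u -> S w -> S (u + w).
  move=> [c [d ->]] [c' [d' ->]]; exists (c + c'), (d + d').
  rewrite /Xcomb -big_split; apply: eq_bigr => i _ /=.
  by rewrite !mxE !scalerDl addrACA.
have SZ a u : S u -> S (a *: u).
  move=> [c [d ->]]; exists (a *: c), (a *: d).
  rewrite /Xcomb scaler_sumr; apply: eq_bigr => i _ /=.
  by rewrite !mxE scalerDr !scalerA.
have SPi u : S u -> S (Pi u).
  by move=> [c [d ->]]; exists (p%:R *: d), c; rewrite Pi_Xcomb.
have SPin n u : S u -> S (iter n Pi u) by move=> Su; elim: n => //= n; apply: SPi.
have Se (i : 'I_g) : S (basis_e W g i.+1).
  rewrite -[basis_e _ _ _](iter_PiinvK (Xexp g i.+1)) -XvecE.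
  apply: SPin.
  exists (delta_mx 0 i), 0; rewrite /Xcomb (bigD1 i) //= big1 => [|j ji].
    by rewrite !mxE !eqxx scale1r scale0r !addr0.
  by rewrite !mxE (negPf ji) andbF !scale0r addr0.
have Sf (i : 'I_g) : S (basis_f W g i.+1).
  rewrite (_ : basis_f W g i.+1 = Pi (basis_e W g i.+1)); first exact: SPi.
  by congr pair; rewrite /= scaler0.
have sum_S (F : 'I_g -> N) : (forall i, S (F i)) -> S (\sum_i F i).
  move=> SF; elim/big_ind: _ => //; exists 0, 0.
  by rewrite /Xcomb big1 // => i _; rewrite !mxE !scale0r addr0.
have -> : v = \sum_(i < g) (v.1 0 i *: basis_e W g i.+1 + v.2 0 i *: basis_f W g i.+1).
  have sum_pair (F : 'I_g -> N) : \sum_i F i = (\sum_i (F i).1, \sum_i (F i).2).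
    by apply: injective_projections; apply: big_morph.
  rewrite sum_pair [LHS]surjective_pairing; congr pair; apply/rowP => j;
    rewrite summxE (bigD1 j) //= big1 => [|i ij];
    by rewrite !mxE ?eqxx ?mulr1 ?mulr0 ?addr0 ?add0r //= eqSS eq_sym
      (negPf (ij : (i != j :> nat))) mulr0.
by apply: sum_S => i; apply: SD; apply: SZ.
Qed.

(** Up to sign, the coordinates of [v] along [X_i] and [Pi X_i] are its pairings
    with [Pi^g X_{g+1-i}] and [Pi^(g-1) X_{g+1-i}]. *)
Lemma Lambda0_dual (v : N) :
  (forall y, exists c, pairing v (iter g.-1 Pi (emb y)) = tofrac c) ->
  (0 < g)%N -> exists x, v = emb x.
Proof.
move=> v_int g_gt0; have v_int' y : exists c, pairing v (iter g Pi (emb y)) = tofrac c.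
  have -> : iter g Pi (emb y) = iter g.-1 Pi (emb (latPi y)).
    by rewrite emb_Pi -iterSr prednK.
  exact: v_int.
have [c [d vE]] := Xcomb_surj v.
pose E j : lat := (delta_mx 0 j, 0).
have EE j : emb (E j) = Xcomb (delta_mx 0 j) 0 by rewrite /emb /= map_delta_mx map_mx0.
have form_E (w : 'rV[K]_g) i :
    revform w (delta_mx 0 (rev_ord i)) = (-1) ^+ Xexp g i.+1 * w 0 i.
  rewrite /revform (bigD1 i) //= big1 ?addr0 => [|j ji].
    by rewrite !mxE !eqxx mulr1.
  by rewrite !mxE (inj_eq rev_ord_inj) (negPf ji) mulr0.
have form_0 (w : 'rV[K]_g) : revform w 0 = 0.
  by rewrite /revform big1 // => j _; rewrite mxE mulr0.
have sgn_int i (w : 'rV[K]_g) :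
    (exists a : W, revform w (delta_mx 0 (rev_ord i)) = tofrac a) ->
    exists a : W, w 0 i = tofrac a.
  move=> [a]; rewrite form_E => wE; exists ((-1) ^+ Xexp g i.+1 * a).
  by rewrite tofracM -wE rmorphXn rmorphN1 mulrA -expr2 sqrr_sign mul1r.
have /fin_all_exists[c' c'E] i : exists a : W, c 0 i = tofrac a.
  apply: sgn_int; have [a aE] := v_int' (E (rev_ord i)); exists a.
  by rewrite -aE EE vE pairing_Xcomb form_0 mulr0 subr0.
have /fin_all_exists[d' d'E] i : exists a : W, d 0 i = tofrac a.
  apply: sgn_int; have [a aE] := v_int (E (rev_ord i)); exists (- a).
  apply: (mulfI (frac_p_neq0 W)).
  have := pairing_Xcomb (p%:R *: d) c (delta_mx 0 (rev_ord i)) 0.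
  rewrite -Pi_Xcomb -vE -EE form_0 mulr0 subr0 revformZl => <-.
  rewrite pairing_Pi -iterS -[X in iter X](_ : 2 + g.-1 = g.+1)%N; last by lia.
  by rewrite iterD /= Pi_Pi pairingZr aE tofracN mulrN.
exists (\row_i c' i, \row_i d' i); rewrite vE /emb.
have -> : map_mx (@tofrac W) (\row_i c' i) = c by apply/rowP => i; rewrite !mxE c'E.
have -> // : map_mx (@tofrac W) (\row_i d' i) = d by apply/rowP => i; rewrite !mxE d'E.
Qed.

Lemma emb_inj : injective emb.
Proof.
move=> x y xy.
suff emb_eq0 z : emb z = 0 -> z = 0.
  by apply/eqP; rewrite -subr_eq0; apply/eqP/emb_eq0; rewrite embB xy subrr.
move=> {x y xy} z0.
have z1 x : emb x = 0 -> x.1 = 0.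
  move=> x0; apply/rowP => i; rewrite mxE.
  have := pairing_emb x (delta_mx 0 (rev_ord i), 0).
  rewrite x0 pairing0l => /esym/eqP; rewrite tofrac_eq0 /hform /=.
  rewrite [revform _ 0]big1 => [|j _]; last by rewrite mxE mulr0.
  rewrite mulr0 subr0 /revform (bigD1 i) //= big1 ?addr0 => [|j ji].
    by rewrite !mxE !eqxx mulr1 mulf_eq0 signr_eq0 => /eqP.
  by rewrite !mxE (inj_eq rev_ord_inj) (negPf ji) mulr0.
have z2 : (latPi z).1 = 0 by apply: z1; rewrite emb_Pi z0; apply: (iter_Pi0 _ _ 1).
have -> : z = (z.1, z.2) by case: (z).
rewrite z1 //; congr pair; apply/rowP => i; have /rowP/(_ i) := z2.
by rewrite !mxE => /eqP; rewrite mulf_eq0 (negPf (witt_p_neq0 W)) => /eqP.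
Qed.

(** ** Residues and Teichmueller expansions *)

Lemma residueD x y : residue (x + y) = residue x + residue y.
Proof. exact: map_mxD. Qed.

Lemma residueZ c x : residue (c *: x) = red W c *: residue x.
Proof. exact: map_mxZ. Qed.

Lemma residue_Pi x : residue (latPi x) = 0.
Proof. by apply/rowP => i; rewrite !mxE rmorphM red_p mul0r. Qed.

Lemma residue_teichv u : residue (teichv u) = u.
Proof. by apply/rowP => i; rewrite !mxE teichK. Qed.

Lemma residue_iter_frob n x i : residue (iter n lat_frob x) 0 i = residue x 0 i ^+ (p ^ n).
Proof.
rewrite !mxE -red_iter_frob; congr (red W _).
by elim: n => //= n; rewrite !mxE => ->.
Qed.

Lemma iter_frob_teichv n (f : nat -> k) :
  iter n lat_frob (teichv (rowv g f)) = teichv (rowv g (fun i => f i ^+ (p ^ n))).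
Proof.
elim: n => [|n IH].
  by congr (teichv _); apply/rowP => i; rewrite !mxE expr1.
rewrite iterS IH; congr pair; apply/rowP => i; rewrite !mxE ?rmorph0 //.
by rewrite frob_teich // -exprM -expnSr.
Qed.

Lemma residue0P x : residue x = 0 -> exists y, x = latPi y.
Proof.
case: x => c d /rowP c0.
have /fin_all_exists[f fE] i : exists e, c 0 i = p%:R * e.
  by apply/red_eq0; have := c0 i; rewrite !mxE.
by exists (d, \row_i f i); congr pair; apply/rowP => i; rewrite !mxE.
Qed.

Lemma residueP x : exists y, x = teichv (residue x) + latPi y.
Proof.
have [|y yE] := @residue0P (x - teichv (residue x)).
  by rewrite residueD -scaleN1r residueZ residue_teichv rmorphN1 scaleN1r subrr.
by exists y; rewrite -yE addrC subrK.
Qed.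

Definition partial_sum (a : nat -> nat -> k) n : lat :=
  \sum_(l < n) iter l latPi (teichv (rowv g (a^~ l))).

Lemma partial_sumS a n :
  partial_sum a n.+1 = partial_sum a n + iter n latPi (teichv (rowv g (a^~ n))).
Proof. exact: big_ord_recr. Qed.

Lemma emb_partial_sum a n : emb (partial_sum a n) =
  \sum_(1 <= i < g.+1) \sum_(0 <= l < n)
    tofrac (teich W (a i l)) *: iter l Pi (Xvec W g i).
Proof.
rewrite emb_sum [RHS]exchange_big /= big_mkord; apply: eq_bigr => l _.
rewrite emb_iter_Pi /emb /Xcomb iter_Pi_sum big_add1 big_mkord.
apply: eq_bigr => i _; rewrite iter_PiD !iter_PiZ !mxE rmorph0 scale0r addr0.
by [].
Qed.

Lemma expansionP v a : expansion v a <->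
  forall n, exists y, v = emb (partial_sum a n + iter n latPi y).
Proof.
split=> va n; have := va n.
  move=> [_ /Lambda0_emb[y ->] E]; exists y; rewrite embD emb_iter_Pi -E.
  by rewrite emb_partial_sum addrC subrK.
move=> [y ->]; exists (emb y); first by apply/Lambda0_emb; exists y.
by rewrite embD emb_partial_sum addrAC subrr add0r emb_iter_Pi.
Qed.

(** Take the residue, lift it, divide the difference by [Pi] and repeat. *)
Lemma expansion_exists v : Lambda0 W g v -> exists a, expansion v a.
Proof.
move=> /Lambda0_emb[x ->].
have [shift shiftE] := boolp.choice residueP.
pose f (u : 'rV[k]_g) n := if insub n.-1 is Some i then u 0 i else 0.
exists (fun i l => f (residue (iter l shift x)) i); apply/expansionP => n.
exists (iter n shift x); congr emb; elim: n => [|n IH].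
  by rewrite /partial_sum big_ord0 add0r.
rewrite partial_sumS {1}IH -addrA iterSr -iter_latPiD [in RHS]iterS; congr (_ + iter n _ _).
rewrite {1}(shiftE (iter n shift x)); congr (teichv _ + _).
by apply/rowP => i; rewrite [RHS]mxE /f valK.
Qed.

(** The digit of index [l] is the residue left after dividing by [Pi^l] what
    the digits of smaller index do not account for. *)
Lemma expansion_unique (v : N) a b : expansion v a -> expansion v b ->
  forall i l, (1 <= i <= g)%N -> a i l = b i l.
Proof.
move=> /expansionP va /expansionP vb.
suff eq_rows l : rowv g (a^~ l) = rowv g (b^~ l).
  move=> [//|i] l /= i_g; have /rowP/(_ (Ordinal i_g)) := eq_rows l.
  by rewrite !mxE.
elim/ltn_ind: l => l IH.
have [x vx] := va l.+1; have [y vy] := vb l.+1.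
have eq_sum : partial_sum a l = partial_sum b l.
  by apply: eq_bigr => j _; rewrite IH.
have /emb_inj : emb (partial_sum a l.+1 + iter l.+1 latPi x)
    = emb (partial_sum b l.+1 + iter l.+1 latPi y) by rewrite -vx -vy.
rewrite !partial_sumS eq_sum -!addrA => /addrI; rewrite !iterSr -!iter_latPiD.
move/iter_latPi_inj/(congr1 residue).
by rewrite !residueD !residue_Pi !residue_teichv !addr0.
Qed.

End Lattice.

Opaque emb.

Arguments emb {p k W g} x.
Arguments latPi {p k W g} x.
Arguments lat_frob {p k W g} x.
Arguments lat_frobV {p k W g} x.
Arguments residue {p k W g} x.
Arguments hform {p k W g} x y.
Arguments teichv {p k} W {g} u.
Arguments partial_sum {p k} W g a n.

(** * The reductions of < v, F^j v > *)

Lemma level_rangeP g l j : level_range g l j ->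
  exists t, [/\ (0 < t)%N, g = (j + l + t.*2)%N & level g l j = - t%:Z].
Proof.
case/and3P=> j_gt0 j_lt; rewrite !modn2 => gl_odd.
have gE : g = (j + l + ((g - (j + l))./2).*2)%N by lia.
exists ((g - (j + l))./2); split=> //; first by lia.
rewrite /level {1}gE; set t := (_./2).
by rewrite (_ : _ - _ = - t%:Z * 2) ?mulzK //; lia.
Qed.

Section Levels.
Context {p : nat} {k : fieldType} (W : witt_ring p k) (p_prime : prime p) (g : nat).
Hypothesis g_gt0 : (0 < g)%N.
Notation K := {fraction witt_carrier W}.
Notation N := (Nspace W g).
Notation lat := (lat W g).
Implicit Types (x y z : lat) (c : W) (a : nat -> nat -> k).

Let p_char : p \in [pchar k] := residue_char W p_prime.

Lemma pidealN t (u : K) :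
  pideal W (- t%:Z) u <-> exists c, p%:R ^+ t * u = tofrac c.
Proof.
have pt_neq0 : p%:R ^+ t != 0 :> K by rewrite expf_neq0 ?frac_p_neq0.
rewrite /pideal /= -exprnN; split=> -[c E]; exists c.
  by rewrite E mulVKf.
by rewrite -E mulKf.
Qed.

Lemma pidealN1 t (u : K) :
  pideal W (- t%:Z + 1) u <-> exists c, p%:R ^+ t * u = tofrac (p%:R * c).
Proof.
have pt_neq0 : p%:R ^+ t != 0 :> K by rewrite expf_neq0 ?frac_p_neq0.
rewrite /pideal /= expfzDr ?frac_p_neq0 // expr1z -exprnN.
split=> -[c E]; exists c.
  by rewrite E -mulrA mulVKf // tofracM tofrac_p.
by apply: (mulfI pt_neq0); rewrite E -mulrA mulVKf // tofracM tofrac_p.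
Qed.

(** Multiplying < x, Pi^j y > by [p^t] turns [j] into [j + 2t], so that every
    level is reached by a suitable exponent [m]. *)
Definition spair m x y : K := pairing (emb x) (iter m Pi (emb y)).

Lemma spairDl m x y z : spair m (x + y) z = spair m x z + spair m y z.
Proof. by rewrite /spair embD pairingDl. Qed.

Lemma spairDr m x y z : spair m z (x + y) = spair m z x + spair m z y.
Proof. by rewrite /spair embD iter_PiD pairingDr. Qed.

Lemma spair_Pil m n x y :
  spair m (iter n latPi x) y = (-1) ^+ n * spair m x (iter n latPi y).
Proof.
by rewrite /spair !emb_iter_Pi pairing_iter_Pi -!iterD addnC.
Qed.

Lemma spair_hform m n x y : g = (m + n)%N ->
  spair m x (iter n latPi y) = tofrac (hform x y).
Proof.
move=> gE; rewrite /spair emb_iter_Pi -iterD -pairing_emb; congr (pairing _ (iter _ _ _)).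
by rewrite gE.
Qed.

Lemma spair_hformS m n x y : g = (m + n)%N ->
  exists c, spair m x (iter n.+1 latPi y) = tofrac (p%:R * c).
Proof.
by move=> gE; rewrite iterSr (spair_hform _ _ gE); have [c ->] := hform_Pir x y; exists c.
Qed.

Lemma spair_double m t x y : spair (t.*2 + m) x y = p%:R ^+ t * spair m x y.
Proof. by rewrite /spair iterD iter_Pi_double pairingZr. Qed.

Lemma spair_pred x y : exists c, spair g.-1 x y = tofrac c.
Proof.
have [c E] := hform_Pir x y; exists c; apply: (mulfI (frac_p_neq0 W)).
rewrite -[X in X * spair _ _ _]expr1 -spair_double.
rewrite -(tofrac_p W) -tofracM -E -pairing_emb emb_Pi -iterSr /spair.
by rewrite (_ : 1.*2 + g.-1 = g.+1)%N //; lia.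
Qed.

Lemma pairing_Fmap_spair j x y :
  pairing (emb x) (iter j Fmap (emb y)) = spair j x (iter j lat_frob y).
Proof. by rewrite emb_iter_F emb_iter_Pi. Qed.

Lemma spair_level t l j x y : g = (j + l + t.*2)%N ->
  p%:R ^+ t * pairing (emb x) (iter j Fmap (emb y))
    = spair (g - l) x (iter j lat_frob y).
Proof.
by move=> gE; rewrite pairing_Fmap_spair -spair_double; congr spair; lia.
Qed.

Lemma reduction_vanishesP l j x : level_range g l j ->
  reduction_vanishes (emb x) l j <->
    exists c, spair (g - l) x (iter j lat_frob x) = tofrac (p%:R * c).
Proof.
case/level_rangeP=> t [_ gE levelE].
by rewrite /reduction_vanishes levelE pidealN1 (spair_level _ _ gE).
Qed.

(** The congruences at the levels [l - 2], [l - 4], ... give integrality at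
    level [l]; at the first two levels it holds on all of [Lambda_0]. *)
Lemma spair_integral l j x : level_range g l j ->
  (forall l', (l' < l)%N -> level_range g l' j -> reduction_vanishes (emb x) l' j) ->
  exists c, spair (g - l) x (iter j lat_frob x) = tofrac c.
Proof.
case: l => [|[|l]] lj IH.
- by exists (hform x (iter j lat_frob x)); rewrite subn0 -(@spair_hform g 0) ?addn0.
- by rewrite subn1; apply: spair_pred.
have lj' : level_range g l j by move: lj; rewrite /level_range !modn2; lia.
have /reduction_vanishesP - /(_ lj') [c E] := IH l (ltnW (ltnSn _)) lj'.
exists c; apply: (mulfI (frac_p_neq0 W)).
rewrite -[X in X * spair _ _ _]expr1 -spair_double -(tofrac_p W) -tofracM -E.
by congr spair; case/level_rangeP: lj => t [_ gE _]; lia.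
Qed.

Lemma residue_partial_sum a n : residue (partial_sum W g a n.+1) = rowv g (a^~ 0%N).
Proof.
rewrite /partial_sum big_ord_recl residueD residue_teichv.
rewrite (_ : residue _ = 0) ?addr0 //.
elim/big_ind: _ => [|u w u0 w0|i _].
- by apply/rowP => i; rewrite !mxE rmorph0.
- by rewrite residueD u0 w0 addr0.
by rewrite /= residue_Pi.
Qed.

Lemma iter_frobD m x y :
  iter m lat_frob (x + y) = iter m lat_frob x + iter m lat_frob y.
Proof. by elim: m => //= m ->; rewrite lat_frobD. Qed.

Lemma iter_frob_iter_Pi m n x :
  iter m lat_frob (iter n latPi x) = iter n latPi (iter m lat_frob x).
Proof. by elim: m => //= m ->; rewrite lat_frob_iter_Pi. Qed.

Lemma frob_partial_sum a n j :
  iter j lat_frob (partial_sum W g a n) = partial_sum W g (fun i l => a i l ^+ (p ^ j)) n.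
Proof.
elim: n => [|n IH].
  rewrite /partial_sum !big_ord0; elim: j => //= j ->.
  by have := @lat_frobZ _ _ W g 0 0; rewrite rmorph0 !scale0r.
rewrite !partial_sumS iter_frobD IH -iter_frob_teichv //; congr (_ + _).
exact: iter_frob_iter_Pi.
Qed.

(** With the unknowns of level [l] set to zero, only data on which [d_{j,l}] may
    depend are left in the levels up to [l]. *)
Definition known a l i r : k := if (r == l) && (uphalf g.+1 < i)%N then 0 else a i r.

Definition unknown a l i : k := if (i <= uphalf g.+1)%N then 0 else a i l.

(** A multiple of [Pi^(l+1)] on either side makes < x, Pi^(g-l) y > divisible by
    [p]. *)
Lemma spair_truncate l j x y a : (l <= g)%N ->
  x = partial_sum W g a l.+1 + iter l.+1 latPi y ->
  exists c, spair (g - l) x (iter j lat_frob x)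
    = spair (g - l) (partial_sum W g a l.+1) (iter j lat_frob (partial_sum W g a l.+1))
      + tofrac (p%:R * c).
Proof.
move=> lg xE; have gE : g = (g - l + l)%N by rewrite subnK.
rewrite {2}xE iter_frobD spairDr iter_frob_iter_Pi.
have [c ->] := spair_hformS x (iter j lat_frob y) gE.
rewrite {1}xE spairDl spair_Pil.
have [c' ->] := spair_hformS y (iter j lat_frob (partial_sum W g a l.+1)) gE.
exists ((-1) ^+ l.+1 * c' + c).
rewrite mulrDr tofracD [p%:R * (_ * c')]mulrCA.
by rewrite [tofrac ((-1) ^+ _ * _)]tofracM rmorphXn rmorphN1 addrA.
Qed.

(** The unknowns of level [l] enter its reduction only through their products
    with the digits of level [0]. *)
Lemma spair_unknown l j a : (l <= g)%N ->
  exists c, [/\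
    spair (g - l) (partial_sum W g a l.+1) (iter j lat_frob (partial_sum W g a l.+1))
      = spair (g - l) (partial_sum W g (known a l) l.+1)
          (iter j lat_frob (partial_sum W g (known a l) l.+1)) + tofrac c
    & red W c = system_lhs p g ((-1) ^+ (g.-1 + l)) a l j].
Proof.
move=> lg; have gE : g = (g - l + l)%N by rewrite subnK.
set P := partial_sum W g a l.+1; set P0 := partial_sum W g (known a l) l.+1.
pose Z := teichv W (rowv g (unknown a l)).
have PE : P = P0 + iter l latPi Z.
  rewrite /P /P0 !partial_sumS -addrA -iter_latPiD; congr (_ + iter l _ _).
    apply: eq_bigr => r _; congr (iter r _ (teichv W _)); apply/rowP => i.
    by rewrite !mxE /known (ltn_eqF (ltn_ord r)).
  congr pair; apply/rowP => i; rewrite !mxE ?addr0 // /known /unknown eqxx /=.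
  by case: leqP => _; rewrite teich0 ?addr0 ?add0r.
pose s : lat -> lat := iter j lat_frob.
exists (hform P0 (s Z) + (-1) ^+ l * hform Z (s P0) + hform (iter l latPi Z) (s Z)).
split.
  rewrite PE -/(s _) /s iter_frobD iter_frob_iter_Pi -/(s _) !spairDl !spairDr.
  rewrite !(spair_hform _ _ gE) (spair_Pil _ _ Z (iter j _ P0)).
  rewrite (spair_hform _ _ gE) [tofrac (_ + hform (iter _ _ _) _)]tofracD.
  rewrite [tofrac (_ + _ * hform _ _)]tofracD [tofrac (_ * hform _ _)]tofracM.
  by rewrite rmorphXn rmorphN1 /s; ring.
have sP0 : residue (s P0) = rowv g (fun i => known a l i 0%N ^+ (p ^ j)).
  by rewrite /s frob_partial_sum residue_partial_sum.
have sZ : residue (s Z) = rowv g (fun i => unknown a l i ^+ (p ^ j)).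
  by rewrite /s iter_frob_teichv // residue_teichv.
have unk0 i : (i <= uphalf g.+1)%N -> unknown a l i = 0 by rewrite /unknown => ->.
rewrite 2!rmorphD rmorphM rmorphXn rmorphN1 !red_hform // sP0 sZ.
rewrite residue_partial_sum residue_teichv.
rewrite (revform_system_high p_char g_gt0 (a := a)) //.
- rewrite (_ : revform _ _ = 0) ?addr0 //; case: (l) => [|l'] /=.
    rewrite residue_teichv (revform_high_high p_char g_gt0) // => i i_le.
    by rewrite /unknown i_le (expr0_pexp p_char).
  by rewrite residue_Pi // /revform big1 // => i _; rewrite mxE mulr0 mul0r.
- by move=> i /andP[i_gt _]; rewrite /unknown leqNgt i_gt.
by move=> i i_le; rewrite /known ifN // negb_and orbC -leqNgt; lia.
Qed.

(** The coefficients [d_{j,l}], read off from the part of [v] that is known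
    before the unknowns of level [l]. *)
Definition dcoef j l a : k :=
  - red W (xget 0 [set c | spair (g - l) (partial_sum W g (known a l) l.+1)
      (iter j lat_frob (partial_sum W g (known a l) l.+1)) = tofrac c]).

Lemma dcoefE j l a c :
  spair (g - l) (partial_sum W g (known a l) l.+1)
    (iter j lat_frob (partial_sum W g (known a l) l.+1)) = tofrac c ->
  dcoef j l a = - red W c.
Proof.
move=> E; congr (- red W _); apply: xget_unique => // c' E'.
by apply: tofrac_inj; rewrite -E -E'.
Qed.

Lemma dcoef_ext j l a b :
  (forall i r, (1 <= i <= g)%N -> (r < l)%N -> a i r = b i r) ->
  (forall i, (1 <= i <= uphalf g.+1)%N -> a i l = b i l) ->
  dcoef j l a = dcoef j l b.
Proof.
move=> ab abl; rewrite /dcoef.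
suff -> : partial_sum W g (known a l) l.+1 = partial_sum W g (known b l) l.+1 by [].
apply: eq_bigr => r _; congr (iter r _ (teichv W _)); apply/rowP => i.
have r_l := ltn_ord r; have i_g := ltn_ord i; rewrite !mxE /known.
case: eqVneq => [->|r_neq] /=; last by apply: ab => //; lia.
by case: leqP => // i_le; apply: abl.
Qed.

Lemma dcoef0 j a : dcoef j 0 a = d0 p g a j.
Proof.
pose P := partial_sum W g (known a 0) 1.
rewrite (@dcoefE j 0 a (hform P (iter j lat_frob P))); last first.
  by rewrite subn0; apply: (@spair_hform g 0); rewrite addn0.
rewrite red_hform // frob_partial_sum !residue_partial_sum.
rewrite (revform_low_low p_char g_gt0) ?opprK; last first.
  by move=> i i_gt; rewrite /known eqxx i_gt.
by apply: (d0_ext p_char g_gt0) => // i /andP[_ i_le]; rewrite /known ltnNge i_le andbF.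
Qed.

(** Digits beyond level [l] do not matter, and the unknowns of level [l] add the
    left hand side of the system to the reduction of the known part. *)
Lemma reduction_eq (v : N) a l j : expansion v a -> level_range g l j ->
  (forall l', (l' < l)%N -> level_range g l' j -> reduction_vanishes v l' j) ->
  pideal W (level g l j) (pairing v (iter j Fmap v)) /\
  forall c, pairing v (iter j Fmap v) = p%:R ^ level g l j * tofrac c ->
    red W c = system_lhs p g ((-1) ^+ (g.-1 + l)) a l j - dcoef j l a.
Proof.
move=> /expansionP/(_ l.+1)[y vE] lj; rewrite {}vE; set x := _ + _ => IH.
have [t [_ gE ->]] := level_rangeP lj.
have [c cE] := spair_integral lj IH.
have lg : (l <= g)%N by lia.
have int : p%:R ^+ t * pairing (emb x) (iter j Fmap (emb x)) = tofrac c.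
  by rewrite (spair_level _ _ gE).
split=> [|c' c'E]; first by apply/pidealN; exists c.
have {c'E} -> : c' = c.
  apply: tofrac_inj; rewrite -int c'E -exprnN mulVKf //.
  by rewrite expf_neq0 ?frac_p_neq0.
have [e] := spair_truncate j lg (erefl x); rewrite cE.
have [b [-> <-]] := spair_unknown j a lg => E.
rewrite (@dcoefE j l a (c - p%:R * e - b)).
  by rewrite opprK !rmorphB rmorphM red_p mul0r subr0 addrC subrK.
by rewrite !tofracB E; ring.
Qed.


(** ** Convergence of the expansion of < v, F^j v > *)

Lemma pairing_sumE a j n : pairing_sum W g a j n
  = pairing (emb (partial_sum W g a n)) (iter j Fmap (emb (partial_sum W g a n))).
Proof.
rewrite pairing_Fmap_spair frob_partial_sum // /spair !emb_partial_sum pairing_suml.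
rewrite /pairing_sum big_nat [RHS]big_nat; apply: eq_bigr => i i_g.
rewrite pairing_suml; apply: eq_bigr => r _.
rewrite iter_Pi_sum pairing_sumr [RHS](bigD1_seq (g.+1 - i)%N) ?iota_uniq //=; last first.
  by rewrite mem_index_iota; lia.
rewrite [X in _ + X]big_seq_cond [X in _ + X]big1 ?addr0 => [|i2 /andP[]]; last first.
  rewrite mem_index_iota => i2_g i2_neq.
  rewrite iter_Pi_sum pairing_sumr big1 // => s _.
  rewrite iter_PiZ -iterD pairingZl pairingZr pairing_iter_Pi -iterD.
  by rewrite pairing_Xvec_neq ?mulr0.
rewrite iter_Pi_sum pairing_sumr; apply: eq_bigr => s _.
rewrite iter_PiZ -iterD pairingZl pairingZr pairing_iter_Pi -iterD teichM tofracM.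
by rewrite (_ : r + (j + s) = r + s + j)%N; [ring | lia].
Qed.

Lemma spair_large m n e x y : (g + m.*2 <= n)%N ->
  exists c, spair (n + e) x y = p%:R ^+ m * tofrac c.
Proof.
move=> n_ge; exists (hform x (iter (n + e - (g + m.*2)) latPi y)).
rewrite -(@spair_hform g 0) ?addn0 // -spair_double /spair /= emb_iter_Pi -iterD.
by congr (pairing _ (iter _ _ _)); lia.
Qed.

Lemma pairing_sum_cvg (v : N) a j : expansion v a -> forall m : nat,
  exists n0, forall n, (n0 <= n)%N ->
    pideal W m%:Z (pairing v (iter j Fmap v) - pairing_sum W g a j n).
Proof.
move=> /expansionP va m; exists (g + m.*2)%N => n n_ge.
have [y vE] := va n; rewrite pairing_sumE vE 2!pairing_Fmap_spair.
set P := partial_sum W g a n.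
rewrite iter_frobD spairDr iter_frob_iter_Pi.
have spair_shift x z : spair j x (iter n latPi z) = spair (n + j) x z.
  by rewrite /spair emb_iter_Pi -iterD addnC.
rewrite spairDl spair_Pil !spair_shift.
have [c ->] := spair_large j (P + iter n latPi y) (iter j lat_frob y) n_ge.
have [c' ->] := spair_large j y (iter j lat_frob P) n_ge.
exists ((-1) ^+ n * c' + c); rewrite tofracD [tofrac (_ * _)]tofracM rmorphXn rmorphN1.
by rewrite -exprnP; ring.
Qed.

End Levels.

(** * Submodules stable under F and V *)

Section Modules.
Context {p : nat} {k : fieldType} (W : witt_ring p k) (p_prime : prime p) (g : nat).
Hypothesis g_gt0 : (0 < g)%N.
Notation K := {fraction witt_carrier W}.
Notation N := (Nspace W g).
Notation lat := (lat W g).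
Implicit Types (x y z : lat) (c : W) (a : nat -> nat -> k) (v w : N) (M : set N).

Let p_char : p \in [pchar k] := residue_char W p_prime.

Lemma submodule_sum M (I : Type) (r : seq I) (P : pred I) (F : I -> N) :
  submodule M -> (forall i, P i -> M (F i)) -> M (\sum_(i <- r | P i) F i).
Proof. by move=> [M0 MD _] MF; elim/big_ind: _. Qed.

Lemma submoduleB M v w : submodule M -> M v -> M w -> M (v - w).
Proof.
move=> [_ MD MZ] Mv Mw; apply: MD => //.
by have := MZ (- 1) w Mw; rewrite tofracN tofrac1 scaleN1r.
Qed.

Lemma VmapD v w : Vmap (v + w) = Vmap v + Vmap w.
Proof.
apply: (can_inj (@FmapK p k W g)).
by rewrite FmapD !Fmap_Vmap scalerDr.
Qed.

Lemma VmapZ c v : Vmap (tofrac c *: v) = tofrac (frobV W c) *: Vmap v.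
Proof.
apply: (can_inj (@FmapK p k W g)).
by rewrite FmapZ !Fmap_Vmap sigma_tofrac frobVK !scalerA mulrC.
Qed.

Lemma Vmap0 : Vmap (0 : N) = 0.
Proof. by have := VmapZ 0 0; rewrite !rmorph0 !scale0r. Qed.

Lemma Dmod_gen v : Dmod v v.
Proof. by move=> M. Qed.

Lemma Dmod_submodule v : submodule (Dmod v).
Proof.
split=> [M M_sub _ _ _|u w Du Dw M M_sub Mv MF MV|c u Du M M_sub Mv MF MV].
- by case: (M_sub).
- by case: (M_sub) => _ MD _; apply: MD; [apply: Du|apply: Dw].
by case: (M_sub) => _ _; apply; apply: Du.
Qed.

Lemma Dmod_F v w : Dmod v w -> Dmod v (Fmap w).
Proof. by move=> Dw M M_sub Mv MF MV; exact: (MF _ (Dw M M_sub Mv MF MV)). Qed.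

Lemma Dmod_V v w : Dmod v w -> Dmod v (Vmap w).
Proof. by move=> Dw M M_sub Mv MF MV; exact: (MV _ (Dw M M_sub Mv MF MV)). Qed.

Lemma Dmod_iter_F n v w : Dmod v w -> Dmod v (iter n Fmap w).
Proof. by move=> Dw; elim: n => //= n; apply: Dmod_F. Qed.

Lemma Dmod_iter_V n v w : Dmod v w -> Dmod v (iter n Vmap w).
Proof. by move=> Dw; elim: n => //= n; apply: Dmod_V. Qed.

Lemma Lambda0_submodule : submodule (Lambda0 W g).
Proof.
split=> [|u w /Lambda0_emb[x ->] /Lambda0_emb[y ->]|c u /Lambda0_emb[x ->]];
  apply/Lambda0_emb.
- by exists 0; rewrite emb0.
- by exists (x + y); rewrite embD.
by exists (c *: x); rewrite embZ.
Qed.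

Lemma Dmod_Lambda0 x w : Dmod (emb x) w -> Lambda0 W g w.
Proof.
apply; first exact: Lambda0_submodule.
- by apply/Lambda0_emb; exists x.
- by move=> u /Lambda0_emb[y ->]; apply/Lambda0_emb; rewrite -emb_F; eexists.
by move=> u /Lambda0_emb[y ->]; apply/Lambda0_emb; rewrite -emb_V; eexists.
Qed.

(** [F] and [V] kill residues, so the residues of the elements of [D v] are
    multiples of that of [v]. *)
Lemma Dmod_residue x w : Dmod (emb x) w ->
  exists u e, w = emb u /\ residue u = e *: residue x.
Proof.
move/(_ [set w | exists u e, w = emb u /\ residue u = e *: residue x]); apply.
- split=> [|_ _ [u [e [-> eu]]] [u' [e' [-> eu']]]|c _ [u [e [-> eu]]]].
  + exists 0, 0; rewrite emb0 scale0r; split=> //.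
    by apply/rowP => i; rewrite !mxE rmorph0.
  + by exists (u + u'), (e + e'); rewrite embD residueD eu eu' scalerDl.
  by exists (c *: u), (red W c * e); rewrite embZ residueZ eu scalerA.
- by exists x, 1; rewrite scale1r.
- move=> _ [u [_ [-> _]]]; exists (latPi (lat_frob u)), 0.
  by rewrite emb_F residue_Pi // scale0r.
move=> _ [u [_ [-> _]]]; exists (latPi (lat_frobV u)), 0.
by rewrite emb_V residue_Pi // scale0r.
Qed.

Lemma emb_iter_tau n x : iter n taumap (emb x) = emb (iter (2 * n) lat_frob x).
Proof.
elim: n => [|n IH]; first by rewrite muln0.
by rewrite iterS IH emb_tau mulnS iterD /=.
Qed.

(** The residues of [tau^s (D v)] are multiples of [sigma^(2s) a]. If they span,
    there is no relation over F_{p^2}, since such a relation is fixed by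
    [sigma^2] and thus annihilates all [sigma^(2s) a]. *)
Lemma free_of_tau_closure x (b : nat -> k) : residue x = rowv g b ->
  (forall w, Lambda0 W g w -> tau_closure (Dmod (emb x)) w) -> free_Fp2 p g b.
Proof.
move=> xb x_tau c c2 cb [//|i] /= i_g.
pose i' := Ordinal i_g; pose E : lat := (delta_mx 0 i', 0).
have [|n [y [Dy]]] := x_tau (emb E); first by apply/Lambda0_emb; exists E.
have /fin_all_exists[u yu] s := Dmod_residue (Dy s).
have /fin_all_exists[e {}yu] := yu.
under eq_bigr => s _ do rewrite (yu s).1 emb_iter_tau.
rewrite -emb_sum => /emb_inj/(congr1 (fun z => \sum_(j < g) c j.+1 * residue z 0 j)).
rewrite [LHS](bigD1 i') //= big1 ?addr0 => [|j ji]; last first.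
  by rewrite !mxE (negPf ji) rmorph0 mulr0.
rewrite !mxE !eqxx rmorph1 mulr1 => ->.
have res_sum (F : 'I_n -> lat) j : residue (\sum_s F s) 0 j = \sum_s residue (F s) 0 j.
  elim/big_rec2: _ => [|s r1 r2 _ <-]; first by rewrite !mxE rmorph0.
  by rewrite residueD mxE.
under eq_bigr do rewrite res_sum mulr_sumr.
rewrite exchange_big big1 //= => s _.
transitivity (e s ^+ (p ^ (2 * s)) * (\sum_(j < g) c j.+1 * b j.+1) ^+ (p ^ (2 * s))).
  rewrite (sum_expr_pchar p_char) mulr_sumr; apply: eq_bigr => j _.
  have c_pow : c j.+1 ^+ (p ^ (2 * s)) = c j.+1.
    by elim: (s : nat) => // q IH; rewrite mulnS expnD exprM c2 // ltn_ord.
  rewrite residue_iter_frob (yu s).2 xb !mxE !exprMn c_pow.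
  by rewrite mulrCA.
by move: cb; rewrite big_add1 big_mkord => ->; rewrite (expr0_pexp p_char) mulr0.
Qed.

(** ** Integrality *)

Definition integral (u : K) := exists c, u = tofrac c.

Lemma integralD (u u' : K) : integral u -> integral u' -> integral (u + u').
Proof. by move=> [c ->] [c' ->]; exists (c + c'); rewrite tofracD. Qed.

Lemma integralN (u : K) : integral (- u) <-> integral u.
Proof.
by split=> -[c E]; exists (- c); rewrite tofracN -E ?opprK.
Qed.

Lemma integral_sigma (u : K) : integral (sigma u) <-> integral u.
Proof.
split=> -[c E].
  by exists (frobV W c); rewrite -(sigmaK u) E -[c in LHS]frobVK -sigma_tofrac sigmaK.
by exists (frob W c); rewrite E sigma_tofrac.
Qed.

Lemma integral_FV v w : integral (pairing (Fmap v) w) <-> integral (pairing v (Vmap w)).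
Proof. by rewrite pairing_Fmap integralN integral_sigma. Qed.

Lemma integral_anti v w : integral (pairing v w) <-> integral (pairing w v).
Proof. by rewrite pairing_anti integralN. Qed.

Lemma integral_iter_FV n v w :
  integral (pairing (iter n Fmap v) w) <-> integral (pairing v (iter n Vmap w)).
Proof.
elim: n w => // n IH w; rewrite iterS integral_FV IH -iterSr.
by [].
Qed.

Lemma dual_submodule M : submodule (dual M).
Proof.
split=> [y _|u w Du Dw y My|c u Du y My].
- by exists 0; rewrite pairing0l tofrac0.
- by rewrite pairingDl; apply: integralD; [apply: Du|apply: Dw].
have [d E] := Du y My; exists (c * d).
by rewrite pairingZl E tofracM.
Qed.

(** [F] and [V] are adjoint up to [sigma], so it is enough to check that [v]
    pairs integrally with its images under powers of [F]. *)
Lemma Dmod_isotropic v : (forall j, integral (pairing v (iter j Fmap v))) ->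
  forall w, Dmod v w -> dual (Dmod v) w.
Proof.
move=> v_int w /(_ (dual (Dmod v))); apply.
- exact: dual_submodule.
- pose P := [set y : N | forall i, integral (pairing v (iter i Fmap y)) /\
                               integral (pairing v (iter i Vmap y))].
  suff DP (u : N) : Dmod v u -> P u by move=> u /DP/(_ 0%N)[].
  move/(_ P); apply=> {u w}.
  + split=> [i|u w Pu Pw i|c u Pu i].
    * have -> : iter i Fmap (0 : N) = 0 by elim: i => //= i ->; rewrite Fmap0.
      have -> : iter i Vmap (0 : N) = 0 by elim: i => //= i ->; rewrite Vmap0.
      by rewrite pairing0r; split; exists 0; rewrite tofrac0.
    * have [uF uV] := Pu i; have [wF wV] := Pw i.
      have -> : iter i Fmap (u + w) = iter i Fmap u + iter i Fmap w.
        by elim: i {uF uV wF wV} => //= i ->; rewrite FmapD.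
      have -> : iter i Vmap (u + w) = iter i Vmap u + iter i Vmap w.
        by elim: i {uF uV wF wV} => //= i ->; rewrite VmapD.
      by rewrite !pairingDr; split; apply: integralD.
    have [[d dE] [e eE]] := Pu i.
    have -> : iter i Fmap (tofrac c *: u) = tofrac (iter i (frob W) c) *: iter i Fmap u.
      by elim: i {dE eE} => //= i ->; rewrite FmapZ sigma_tofrac.
    have -> : iter i Vmap (tofrac c *: u) = tofrac (iter i (frobV W) c) *: iter i Vmap u.
      by elim: i {dE eE} => //= i ->; rewrite VmapZ.
    rewrite !pairingZr dE eE -!tofracM.
    by split; eexists.
  + by move=> i; split=> //; apply/integral_iter_FV/integral_anti.
  + move=> y Py i; rewrite -iterSr; split; first by have [] := Py i.+1.
    case: i => [|i]; first by have [] := Py 1%N.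
    rewrite iterSr Vmap_Fmap.
    have -> : iter i Vmap (p%:R *: y) = p%:R *: iter i Vmap y.
      by elim: i => //= i ->; rewrite -(tofrac_p W) VmapZ rmorph_nat.
    have [_ [d dE]] := Py i; exists (p%:R * d).
    by rewrite pairingZr dE tofracM tofrac_p.
  move=> y Py i; rewrite -[iter i Vmap _]iterSr; split; last by have [] := Py i.+1.
  case: i => [|i]; first by have [] := Py 1%N.
  rewrite iterSr Fmap_Vmap.
  have -> : iter i Fmap (p%:R *: y) = p%:R *: iter i Fmap y.
    by elim: i => //= i ->; rewrite FmapZ rmorph_nat.
  have [[d dE] _] := Py i; exists (p%:R * d).
  by rewrite pairingZr dE tofracM tofrac_p.
- move=> u Du y Dy; apply/integral_FV; apply: Du; exact: Dmod_V.
move=> u Du y Dy; apply/integral_anti/integral_FV/integral_anti.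
by apply: Du; apply: Dmod_F.
Qed.

End Modules.

(** * The module D v for a vector with independent residues *)

Section FreeResidue.
Context {p : nat} {k : fieldType} (W : witt_ring p k) (p_prime : prime p) (g : nat).
Hypothesis g_gt0 : (0 < g)%N.
Notation K := {fraction witt_carrier W}.
Notation N := (Nspace W g).
Notation lat := (lat W g).
Implicit Types (x y z : lat) (c : W) (v w : N) (M : set N).

Let p_char : p \in [pchar k] := residue_char W p_prime.

Definition free_residue x := exists2 b, residue x = rowv g b & free_Fp2 p g b.

Lemma free_Fp2_ext n (b b' : nat -> k) :
  (forall i, (1 <= i <= n)%N -> b i = b' i) -> free_Fp2 p n b -> free_Fp2 p n b'.
Proof.
move=> bb' b_free c c2 cb'; apply: b_free => //; rewrite -[RHS]cb' big_nat [RHS]big_nat.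
by apply: eq_bigr => i i_n; rewrite bb'.
Qed.

Lemma residue_sum (I : Type) (r : seq I) (P : pred I) (F : I -> lat) :
  residue (\sum_(i <- r | P i) F i) = \sum_(i <- r | P i) residue (F i).
Proof.
have residue0 : residue (0 : lat) = 0 by apply/rowP => i; rewrite !mxE rmorph0.
exact: (big_morph _ (@residueD _ _ W g) residue0).
Qed.

Lemma free_residue_frob n x : free_residue x -> free_residue (iter n lat_frob x).
Proof.
move=> [b xb b_free]; exists (fun i => b i ^+ (p ^ n)); last exact: free_Fp2_pexp.
by apply/rowP => i; rewrite residue_iter_frob xb !mxE.
Qed.

Lemma iter_frobK n x : iter n lat_frob (iter n lat_frobV x) = x.
Proof. by elim: n => // n IH; rewrite iterSr iterS lat_frobVK. Qed.

Lemma free_residue_frobV n x : free_residue x -> free_residue (iter n lat_frobV x).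
Proof.
move=> [b xb b_free]; set y := iter n lat_frobV x.
pose f i := if insub i.-1 is Some j then residue y 0 j else 0.
have fE (j : 'I_g) : f j.+1 = residue y 0 j by rewrite /f valK.
exists f; first by apply/rowP => j; rewrite [RHS]mxE fE.
apply: (free_Fp2_root p_char (m := n)); apply: free_Fp2_ext b_free => -[//|i] /= i_g.
have := residue_iter_frob n y (Ordinal i_g).
by rewrite /y iter_frobK xb mxE -/y -fE.
Qed.

Lemma twist_row_free n x : (n <= g)%N -> free_residue x ->
  row_free (\matrix_(s < n) residue (iter (2 * s) lat_frob x)).
Proof.
move=> ng [b xb b_free]; have := moore_row_free p_char ng (free_Fp2_leq p_char ng b_free).
congr (row_free _); apply/matrixP => s i.
by rewrite [RHS]mxE residue_iter_frob xb !mxE.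
Qed.

(** Modulo [p] the matrix of the family [y_s, Pi y'_s] is block triangular, the
    diagonal blocks being made of the residues of the [y_s] and the [y'_s]. *)
Lemma lat_generators (y y' : 'I_g -> lat) :
  row_free (\matrix_s residue (y s)) -> row_free (\matrix_s residue (y' s)) ->
  forall x, exists c d : 'I_g -> W,
    x = \sum_s c s *: y s + \sum_s d s *: latPi (y' s).
Proof.
move=> y_free y'_free x.
pose Y1 := \matrix_s (y s).1; pose Y2 := \matrix_s (y s).2.
pose Z1 := \matrix_s (p%:R *: (y' s).2); pose Z2 := \matrix_s (y' s).1.
pose T := block_mx Y1 Y2 Z1 Z2.
have T_unit : T \in unitmx.
  rewrite unitmxE; apply: (witt_unit (W := W)).
  rewrite -det_map_mx map_block_mx (_ : map_mx _ Z1 = 0); last first.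
    by apply/matrixP => s i; rewrite !mxE rmorphM red_p // mul0r.
  rewrite det_ublock mulf_neq0 // -unitfE -unitmxE -row_free_unit.
    by congr (is_true (row_free _)): y_free; apply/matrixP => s i; rewrite !mxE.
  by congr (is_true (row_free _)): y'_free; apply/matrixP => s i; rewrite !mxE.
pose cd := row_mx x.1 x.2 *m invmx T.
have xE : row_mx x.1 x.2 = cd *m T by rewrite /cd mulmxKV.
exists (fun s => lsubmx cd 0 s), (fun s => rsubmx cd 0 s).
have /eq_row_mx[x1 x2] : row_mx x.1 x.2 =
    row_mx (lsubmx cd *m Y1 + rsubmx cd *m Z1) (lsubmx cd *m Y2 + rsubmx cd *m Z2).
  by rewrite -mul_row_block hsubmxK.
have fst_sum (F : 'I_g -> lat) : (\sum_s F s).1 = \sum_s (F s).1 by apply: big_morph.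
have snd_sum (F : 'I_g -> lat) : (\sum_s F s).2 = \sum_s (F s).2 by apply: big_morph.
have mulE (u : 'rV[W]_g) (F : 'I_g -> 'rV[W]_g) :
    u *m (\matrix_s F s) = \sum_s u 0 s *: F s.
  by rewrite mulmx_sum_row; apply: eq_bigr => s _; rewrite rowK.
apply: injective_projections => /=.
  by rewrite x1 fst_sum fst_sum !mulE.
by rewrite x2 snd_sum snd_sum !mulE.
Qed.

Section Span.
Variables (x : lat) (x_free : free_residue x).

(** This is [sigma^(2s-n) v], and [F^s V^(n-s) v] is its image under [Pi^n]. *)
Definition twist n s : lat := iter (2 * s) lat_frob (iter n lat_frobV x).

Lemma emb_twist n s : (s <= n)%N ->
  iter s Fmap (iter (n - s) Vmap (emb x)) = emb (iter n latPi (twist n s)).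
Proof.
move=> sn; rewrite emb_iter_V emb_iter_F iter_frob_iter_Pi -(iterD s (n - s)) (subnKC sn).
have E : iter n lat_frobV x = iter s lat_frobV (iter (n - s) lat_frobV x).
  by rewrite -iterD subnKC.
by rewrite /twist E mul2n -addnn iterD iter_frobK.
Qed.

Lemma Dmod_twist n s : (s <= n)%N -> Dmod (emb x) (emb (iter n latPi (twist n s))).
Proof.
move=> sn; rewrite -emb_twist //; apply: Dmod_iter_F; apply: Dmod_iter_V.
exact: Dmod_gen.
Qed.

Lemma twist_free n m : (m <= g)%N ->
  row_free (\matrix_(s < m) residue (twist n s)).
Proof. by move=> mg; apply: twist_row_free mg _; apply: free_residue_frobV. Qed.

Lemma twist_free_shift n : row_free (\matrix_(s < g) residue (twist n s.+1)).
Proof.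
have := twist_row_free (leqnn g) (free_residue_frob 2 (free_residue_frobV n x_free)).
congr (row_free _); apply/row_matrixP => s; rewrite !rowK /twist.
by rewrite mulnS addnC [in RHS]iterD.
Qed.

(** ** The basis F^i v (i <= g), V^i v (1 <= i < g) *)

Definition gen (i : nat) : lat :=
  if (i <= g)%N then iter i latPi (iter i lat_frob x)
  else iter (i - g) latPi (iter (i - g) lat_frobV x).

Definition gen_span : set N :=
  [set w | exists c : 'I_(2 * g) -> W, w = \sum_i tofrac (c i) *: emb (gen i)].

Lemma gen_span_submodule : submodule gen_span.
Proof.
split=> [|_ _ [c ->] [d ->]|c _ [d ->]].
- by exists (fun _ => 0); rewrite big1 // => i _; rewrite tofrac0 scale0r.
- exists (fun i => c i + d i); rewrite -big_split; apply: eq_bigr => i _.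
  by rewrite tofracD scalerDl.
exists (fun i => c * d i); rewrite scaler_sumr; apply: eq_bigr => i _.
by rewrite tofracM scalerA.
Qed.

Lemma gen_span_gen i : (i < 2 * g)%N -> gen_span (emb (gen i)).
Proof.
move=> i_lt; exists (fun j => (j == Ordinal i_lt)%:R).
rewrite (bigD1 (Ordinal i_lt)) //= big1 => [|j /negPf ->].
  by rewrite eqxx tofrac1 scale1r addr0.
by rewrite tofrac0 scale0r.
Qed.

Lemma submodule_p M n w : submodule M -> M w -> M (p%:R ^+ n *: w).
Proof.
move=> [_ _ MZ] Mw; rewrite -(tofrac_p W) -tofracXn.
exact: MZ.
Qed.

Lemma gen_span_F i : (i <= g)%N -> gen_span (emb (iter i latPi (iter i lat_frob x))).
Proof. by move=> ig; have := @gen_span_gen i; rewrite /gen ig; apply; lia. Qed.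

Lemma gen_span_V i : (i < g)%N -> gen_span (emb (iter i latPi (iter i lat_frobV x))).
Proof.
case: i => [|i] ig; first by apply: (@gen_span_F 0).
have := @gen_span_gen (g + i.+1); rewrite /gen addKn ifN; last by lia.
by apply; lia.
Qed.

Lemma gen_span_twist n s : (s <= n <= g)%N -> (0 < s)%N || (n < g)%N ->
  gen_span (emb (iter n latPi (twist n s))).
Proof.
move=> /andP[sn ng] edge; have span_p := submodule_p _ gen_span_submodule.
have [ns|ns] := leqP n (2 * s).
  have -> : iter n latPi (twist n s) = p%:R ^+ (n - s) *:
      iter (2 * s - n) latPi (iter (2 * s - n) lat_frob x).
    rewrite /twist -{1}(subnK ns) iterD iter_frobK -iter_latPi_double -iterD.
    by congr (iter _ _ _); lia.
  rewrite embZ tofracXn tofrac_p; apply: span_p.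
  by apply: gen_span_F; lia.
have -> : iter n latPi (twist n s) = p%:R ^+ s *:
    iter (n - 2 * s) latPi (iter (n - 2 * s) lat_frobV x).
  rewrite /twist -{2}(subnKC (ltnW ns)) iterD iter_frobK -iter_latPi_double -iterD.
  by congr (iter _ _ _); lia.
rewrite embZ tofracXn tofrac_p; apply: span_p.
by apply: gen_span_V; lia.
Qed.

(** [Pi^(g-1) Lambda_0] is generated by the [Pi^(g-1) sigma^(2s-g+1) v] and the
    [Pi^g sigma^(2s+2-g) v] with [s < g], which are [p]-power multiples of the
    [F^i v] and [V^i v]. *)
Lemma gen_span_Pi y : gen_span (emb (iter g.-1 latPi y)).
Proof.
have [c [d ->]] := lat_generators (twist_free g.-1 (leqnn g)) (twist_free_shift g) y.
have [_ spanD spanZ] := gen_span_submodule.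
rewrite iter_latPiD !iter_latPi_sum embD !emb_sum; apply: spanD.
  apply: submodule_sum gen_span_submodule _ => s _.
  rewrite iter_latPiZ embZ; apply: spanZ; apply: gen_span_twist; have := ltn_ord s; lia.
apply: submodule_sum gen_span_submodule _ => s _.
rewrite iter_latPiZ embZ; apply: spanZ; rewrite -iterSr prednK //.
by apply: gen_span_twist; have := ltn_ord s; lia.
Qed.

Lemma gen_span_ge n y : (g.-1 <= n)%N -> gen_span (emb (iter n latPi y)).
Proof. by move=> n_ge; rewrite -(subnKC n_ge) iterD; apply: gen_span_Pi. Qed.

(** The span is stable under [F] and [V], as [F^(g+1) v] and [V^g v] lie in
    [Pi^(g-1) Lambda_0]. *)
Lemma DmodE : Dmod (emb x) = gen_span.
Proof.
apply/seteqP; split=> w.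
  have span_p := submodule_p 1 gen_span_submodule.
  have [_ _ spanZ] := gen_span_submodule.
  apply; first exact: gen_span_submodule.
  - exact: (@gen_span_F 0).
  - move=> _ [c ->]; rewrite (big_morph Fmap (@FmapD _ _ W g) (@Fmap0 _ _ W g)).
    apply: submodule_sum gen_span_submodule _ => i _.
    rewrite FmapZ sigma_tofrac; apply: spanZ; rewrite /gen.
    case: (leqP i g) => ig.
      rewrite -emb_iter_F -iterS emb_iter_F.
      case: (ltnP i g) => ig'; first exact: gen_span_F.
      by apply: gen_span_ge; lia.
    rewrite -(subnSK ig) -emb_iter_V iterS Fmap_Vmap emb_iter_V.
    by apply: span_p; apply: gen_span_V; have := ltn_ord i; lia.
  move=> _ [c ->]; rewrite (big_morph Vmap (@VmapD _ _ W g) (@Vmap0 _ _ W g)).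
  apply: submodule_sum gen_span_submodule _ => i _.
  rewrite VmapZ; apply: spanZ; rewrite /gen.
  case: (leqP i g) => ig.
    case: (nat_of_ord i) ig => [|i'] ig.
      rewrite -[iter 0 _ _]/(iter 0 latPi (iter 0 lat_frobV x)) -emb_iter_V -iterS.
      rewrite emb_iter_V; case: (ltnP 1 g) => g_gt1; first exact: gen_span_V.
      by apply: gen_span_ge; lia.
    rewrite -emb_iter_F iterS Vmap_Fmap emb_iter_F.
    by apply: span_p; apply: gen_span_F; lia.
  rewrite -emb_iter_V -iterS emb_iter_V.
  case: (ltnP (i - g).+1 g) => ig'; first exact: gen_span_V.
  by apply: gen_span_ge; lia.
move=> [c ->]; have [_ _ DZ] := Dmod_submodule (emb x).
apply: submodule_sum (Dmod_submodule _) _ => i _; apply: DZ; rewrite /gen.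
case: leqP => _; rewrite -?emb_iter_F -?emb_iter_V.
  by apply: Dmod_iter_F; apply: Dmod_gen.
by apply: Dmod_iter_V; apply: Dmod_gen.
Qed.

Lemma Dmod_ge n y : (g.-1 <= n)%N -> Dmod (emb x) (emb (iter n latPi y)).
Proof. by rewrite DmodE; apply: gen_span_ge. Qed.

(** The [2 g] generators span the [2 g]-dimensional space over the fraction
    field, hence are independent. *)
Lemma Dmod_lattice : is_lattice (Dmod (emb x)).
Proof.
exists (fun i => emb (gen i)); split; last exact: DmodE.
move=> c c0.
have {c0} c0 : \sum_(i < 2 * g) c i *: gen i = 0.
  by apply: emb_inj; rewrite emb_sum emb0 -[RHS]c0; apply: eq_bigr => i _; rewrite embZ.
pose row y : 'rV[K]_(g + g) := map_mx (@tofrac W) (row_mx y.1 y.2).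
have rowD y z : row (y + z) = row y + row z.
  by rewrite /row -map_mxD add_row_mx.
have rowZ e y : row (e *: y) = tofrac e *: row y.
  by rewrite /row -map_mxZ scale_row_mx.
have row0 : row 0 = 0 by rewrite -(scale0r 0) rowZ tofrac0 scale0r.
have row_sum (F : 'I_(2 * g) -> lat) : row (\sum_i F i) = \sum_i row (F i).
  exact: (big_morph row rowD row0).
pose B := \matrix_(i < 2 * g) row (gen i).
have B_full : (1%:M <= B)%MS.
  apply/row_subP => j; rewrite row1.
  pose e : lat := (lsubmx (delta_mx 0 j), rsubmx (delta_mx 0 j)).
  have rowe : row e = delta_mx 0 j by rewrite /row hsubmxK map_delta_mx.
  have [d dE] := gen_span_Pi (iter g.-1 latPi e).
  have {dE} : p%:R ^+ g.-1 *: e = \sum_i d i *: gen i.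
    apply: emb_inj; rewrite emb_sum -iter_latPi_double -addnn iterD dE.
    by apply: eq_bigr => i _; rewrite embZ.
  move/(congr1 row); rewrite rowZ rowe row_sum => E.
  have pg_neq0 : tofrac (p%:R ^+ g.-1 : W) != 0.
    by rewrite tofrac_eq0 expf_neq0 ?witt_p_neq0.
  rewrite -[delta_mx 0 j](scalerK pg_neq0) E; apply/scalemx_sub/summx_sub => i _.
  by rewrite rowZ -(rowK (fun i => row (gen i)) i); apply/scalemx_sub/row_sub.
have B_free : row_free B.
  rewrite /row_free eqn_leq rank_leq_row /=.
  by have := mxrankS B_full; rewrite mxrank1; lia.
pose u := \row_i tofrac (c i).
have : u = 0.
  apply: (row_free_inj B_free); rewrite mul0mx mulmx_sum_row -[RHS]row0 -c0 row_sum.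
  by apply: eq_bigr => i _; rewrite rowK mxE rowZ.
move/rowP => u0 i; have := u0 i; rewrite !mxE => /eqP.
by rewrite tofrac_eq0 => /eqP.
Qed.

(** ** The tau-closure *)

(** The [sigma^(2s) (F^n v)] with [s < g] have independent residues in
    [Pi^n Lambda_0], so that [Lambda_0] is reached by successive approximation. *)
Lemma Dmod_tau_closure : tau_closure (Dmod (emb x)) = Lambda0 W g.
Proof.
have D_sub := Dmod_submodule (emb x); have [D0 DD DZ] := D_sub.
apply/seteqP; split=> w.
  move=> [n [y [Dy ->]]]; apply: submodule_sum (Lambda0_submodule W g) _ => s _.
  have /Lambda0_emb[u ->] := Dmod_Lambda0 (Dy s).
  by apply/Lambda0_emb; rewrite emb_iter_tau; eexists.
move=> /Lambda0_emb[z ->].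
suff approx m : forall n u, (g.-1 - n < m)%N ->
    exists y : 'I_g -> N, (forall s, Dmod (emb x) (y s)) /\
      emb (iter n latPi u) = \sum_(s < g) iter s taumap (y s).
  by have [y [Dy zE]] := approx _ 0%N z (leqnn _); exists g, y.
elim: m {z} => // m IH n z n_lt.
have [n_ge|n_lt'] := leqP g.-1 n.
  exists (fun s => if s == 0%N :> nat then emb (iter n latPi z) else 0); split.
    by move=> s; case: ifP => // _; apply: Dmod_ge.
  rewrite (bigD1 (Ordinal g_gt0)) //= big1 ?addr0 // => s s_neq0.
  rewrite ifN //; have := emb_iter_tau s (0 : lat); rewrite emb0 => ->.
  have frob0 : lat_frob (0 : lat) = 0.
    by have := @lat_frobZ _ _ W g 0 0; rewrite rmorph0 !scale0r.
  have -> : iter (2 * s) lat_frob (0 : lat) = 0 by elim: (2 * s)%N => //= q ->.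
  exact: emb0.
pose x' := iter n lat_frob x.
have A_free := twist_row_free (leqnn g) (free_residue_frob n x_free).
have /submxP[l lE] : (residue z <= \matrix_(s < g) residue (iter (2 * s) lat_frob x'))%MS.
  by apply: submx_full; rewrite row_full_unit -row_free_unit.
have /fin_all_exists[m' m'E] (s : 'I_g) := residue_root W (2 * s) (l 0 s).
pose y (s : 'I_g) := teich W (m' s) *: x'.
have [z' z'E] : exists z', z - \sum_(s < g) iter (2 * s) lat_frob (y s) = latPi z'.
  apply: residue0P; rewrite residueD -scaleN1r residueZ rmorphN1 scaleN1r lE.
  rewrite residue_sum mulmx_sum_row; apply/eqP; rewrite subr_eq0; apply/eqP.
  apply: eq_bigr => s _; apply/rowP => i.
  rewrite rowK [LHS]mxE !residue_iter_frob residueZ teichK [in RHS]mxE.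
  by rewrite exprMn m'E residue_iter_frob.
have [|u [Du uE]] := IH n.+1 z'; first by lia.
exists (fun s => emb (iter n latPi (y s)) + u s); split=> [s|].
  apply: (DD _ _ _ (Du s)); rewrite iter_latPiZ embZ; apply: DZ.
  by rewrite -emb_iter_F; apply: Dmod_iter_F; apply: Dmod_gen.
have /fin_all_exists[u' u'E] s : exists z, u s = emb z.
  by apply/Lambda0_emb; apply: Dmod_Lambda0 (Du s).
have -> : z = \sum_(s < g) iter (2 * s) lat_frob (y s) + latPi z'.
  by rewrite -z'E addrC subrK.
rewrite iter_latPiD embD -iterSr uE iter_latPi_sum emb_sum -big_split.
apply: eq_bigr => s _ /=; rewrite u'E -embD 2!(emb_iter_tau s).
by rewrite iter_frobD embD iter_frob_iter_Pi.
Qed.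

(** ** Self-duality *)

(** An element of the dual lying in [Pi^n Lambda_0] has its residue orthogonal
    to the [g - 1 - n] residues of [D v] in [Pi^(g-2-n) Lambda_0]; for dimension
    reasons it lies in the span of the [n + 1] residues of [D v] in
    [Pi^n Lambda_0], and can be moved into [Pi^(n+1) Lambda_0]. *)
Lemma Dmod_dual : (forall j, integral (pairing (emb x) (iter j Fmap (emb x)))) ->
  dual (Dmod (emb x)) = Dmod (emb x).
Proof.
move=> x_int; apply/seteqP; split=> w; last exact: Dmod_isotropic.
have D_sub := Dmod_submodule (emb x); have [D0 DD DZ] := D_sub.
have dual_sub := dual_submodule (Dmod (emb x)).
have orth n r z t : (n + r).+2 = g -> dual (Dmod (emb x)) (emb (iter n latPi z)) ->
    (t <= r)%N -> revform (residue z) (residue (twist r t)) = 0.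
  move=> nr z_dual tr; have [c cE] := z_dual _ (Dmod_twist tr).
  have gE : g = (1.*2 + r + n)%N by lia.
  have : p%:R ^+ 1 * spair r (iter n latPi z) (twist r t) = tofrac (p%:R * c).
    by rewrite tofracM tofrac_p expr1 -cE /spair (emb_iter_Pi r).
  rewrite -spair_double spair_Pil (spair_hform _ _ gE).
  rewrite -[_ ^+ n](rmorph_sign (@tofrac W)) -tofracM => /tofrac_inj/(congr1 (red W)).
  rewrite !rmorphM red_p // mul0r rmorph_sign red_hform // => /eqP.
  by rewrite mulf_eq0 signr_eq0 => /eqP.
move=> w_dual; have [|z wz] := @Lambda0_dual _ _ W p_prime g w _ g_gt0.
  move=> y; rewrite -emb_iter_Pi; apply: w_dual.
  exact: Dmod_ge.
move: w_dual; rewrite wz => {w wz}.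
suff approx m : forall n u, (g.-1 - n < m)%N ->
    dual (Dmod (emb x)) (emb (iter n latPi u)) -> Dmod (emb x) (emb (iter n latPi u)).
  exact: (approx _ 0%N z (leqnn _)).
elim: m {z} => // m IH n z n_lt z_dual.
have [n_ge|n_lt'] := leqP g.-1 n; first exact: Dmod_ge.
pose r := (g - n.+2)%N; have nr : (n + r).+2 = g by lia.
have tw_dual s : (s <= n)%N -> dual (Dmod (emb x)) (emb (iter n latPi (twist n s))).
  by move=> sn; apply: Dmod_isotropic x_int _ (Dmod_twist sn).
have /submxP[l lE] : (residue z <= \matrix_(s < n.+1) residue (twist n s))%MS.
  apply: (orthogonal_span (B := \matrix_(t < r.+1) residue (twist r t))).
  - by lia.
  - by apply: twist_free; lia.
  - by apply: twist_free; lia.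
  - move=> s t; rewrite !rowK.
    exact: (orth n r _ t nr (tw_dual s (leq_ord s)) (leq_ord t)).
  by move=> t; rewrite rowK; apply: (orth n r _ t nr z_dual (leq_ord t)).
pose y := \sum_(s < n.+1) teich W (l 0 s) *: twist n s.
have [z' z'E] : exists z', z - y = latPi z'.
  apply: residue0P; rewrite residueD -scaleN1r residueZ rmorphN1 scaleN1r lE.
  rewrite residue_sum mulmx_sum_row; apply/eqP; rewrite subr_eq0; apply/eqP.
  by apply: eq_bigr => s _; rewrite rowK residueZ teichK.
have yE : emb (iter n latPi y)
    = \sum_(s < n.+1) tofrac (teich W (l 0 s)) *: emb (iter n latPi (twist n s)).
  by rewrite iter_latPi_sum emb_sum; apply: eq_bigr => s _; rewrite iter_latPiZ embZ.
have zE : emb (iter n latPi z) = emb (iter n latPi y) + emb (iter n.+1 latPi z').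
  by rewrite iterSr -z'E -embD -iter_latPiD addrC subrK.
have y_in M : submodule M ->
    (forall s, (s <= n)%N -> M (emb (iter n latPi (twist n s)))) ->
    M (emb (iter n latPi y)).
  move=> M_sub M_tw; rewrite yE; apply: submodule_sum (M_sub) _ => s _.
  by have [_ _] := M_sub; apply; apply: M_tw; rewrite -ltnS.
rewrite zE; apply: DD.
  by apply: y_in => // s; apply: Dmod_twist.
apply: IH; first by lia.
have -> : emb (iter n.+1 latPi z') = emb (iter n latPi z) - emb (iter n latPi y).
  by rewrite zE addrC addKr.
exact: (submoduleB dual_sub z_dual (y_in _ dual_sub tw_dual)).
Qed.

End Span.
End FreeResidue.

(** * Comparison of the two descriptions *)

Section Comparison.
Context {p : nat} {k : fieldType} (W : witt_ring p k) (p_prime : prime p) (g : nat).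
Hypothesis g_gt0 : (0 < g)%N.
Notation lat := (lat W g).
Implicit Types (x : lat) (v : Nspace W g) (a : nat -> nat -> k).

Let p_char : p \in [pchar k] := residue_char W p_prime.

Lemma residue_expansion x a : expansion (emb x) a -> residue x = rowv g (a^~ 0%N).
Proof.
move=> /expansionP/(_ 1%N)[y /emb_inj->].
by rewrite residueD residue_Pi // residue_partial_sum // addr0.
Qed.

(** In the given range the exponent [(j + l - g) / 2 + 1] is at most [0]. *)
Lemma vanishes_of_integral v l j : level_range g l j ->
  integral (pairing v (iter j Fmap v)) -> reduction_vanishes v l j.
Proof.
case/level_rangeP=> t [t_gt0 gE levelE] [c E]; rewrite /reduction_vanishes levelE.
apply/pidealN1; exists (p%:R ^+ t.-1 * c).
by rewrite E -(tofrac_p W) -tofracXn -tofracM mulrA -exprS prednK.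
Qed.

(** For [1 <= j <= g - 2] the last congruence is that of level [g - 2 - j]; for
    larger [j] the pairing is integral on all of [Lambda_0]. *)
Lemma integral_of_vanishes x :
  (forall l j, level_range g l j -> reduction_vanishes (emb x) l j) ->
  forall j, integral (pairing (emb x) (iter j Fmap (emb x))).
Proof.
move=> x_van [|j]; first by exists 0; rewrite pairing_alt tofrac0.
rewrite pairing_Fmap_spair; set y := iter _ _ _.
have [j_ge|j_lt] := leqP g.-1 j.+1.
  have [c E] := spair_pred p_prime g_gt0 x (iter (j.+1 - g.-1) latPi y); exists c.
  by rewrite -E /spair emb_iter_Pi -iterD subnKC.
have lj : level_range g (g - j.+3) j.+1 by rewrite /level_range !modn2; lia.
have /(reduction_vanishesP p_prime g_gt0 x lj)[c] := x_van _ _ lj.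
rewrite (_ : g - (g - j.+3) = 1.*2 + j.+1)%N ?spair_double; last by lia.
move=> E; exists c; apply: (mulfI (frac_p_neq0 W)).
by rewrite -{1}[p%:R]expr1 E tofracM tofrac_p.
Qed.

Lemma system0P v a : expansion v a ->
  system0 p g a <-> (forall j, level_range g 0 j -> reduction_vanishes v 0 j).
Proof.
move=> va.
have eqv j : level_range g 0 j ->
    system_lhs p g ((-1) ^+ g.-1) a 0 j = d0 p g a j <-> reduction_vanishes v 0 j.
  move=> lj; have [//|[c cE] redE] := reduction_eq p_prime g_gt0 va lj.
  have := redE c cE; rewrite addn0 dcoef0 // => redc.
  have pn_neq0 : p%:R ^ level g 0 j != 0 :> {fraction witt_carrier W}.
    by rewrite expfz_neq0 ?frac_p_neq0.
  rewrite /reduction_vanishes /pideal /= cE.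
  split=> [E|[c' c'E]].
    have [c' c'E] : exists c', c = p%:R * c' by apply/red_eq0; rewrite redc E subrr.
    exists c'; rewrite c'E tofracM tofrac_p mulrA expfzDr ?frac_p_neq0 //.
  apply/eqP; rewrite -subr_eq0 -redc; apply/eqP/red_eq0; exists c'.
  apply: tofrac_inj; apply: (mulfI pn_neq0).
  by rewrite c'E expfzDr ?frac_p_neq0 // expr1z tofracM tofrac_p mulrA.
by split=> sys j lj; apply/eqv => //; apply: sys.
Qed.

Lemma admissibleP x a : expansion (emb x) a ->
  admissible (emb x) a <->
    leading_free p g a /\
    forall j, integral (pairing (emb x) (iter j Fmap (emb x))).
Proof.
move=> xa; split=> [[a_free a_sys a_van]|[a_free x_int]].
  split=> //; apply: integral_of_vanishes => -[|l] j lj; last exact: a_van.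
  by move/(system0P xa): a_sys; apply.
split=> [//||l j _ lj]; last exact: vanishes_of_integral.
by apply/(system0P xa) => j lj; apply: vanishes_of_integral.
Qed.

Lemma special_vectorsP v :
  [/\ is_lattice (Dmod v), tau_closure (Dmod v) = Lambda0 W g & dual (Dmod v) = Dmod v]
  <-> Lambda0 W g v /\ exists a, expansion v a /\ admissible v a.
Proof.
split=> [[_ v_tau v_dual]|[/Lambda0_emb[x ->] [a [xa /(admissibleP xa)[a_free x_int]]]]].
  have v_in : Lambda0 W g v.
    rewrite -v_tau; exists 1%N, (fun _ => v); split=> [_|]; first exact: Dmod_gen.
    by rewrite big_ord1.
  split=> //; have [a va] := expansion_exists v_in; exists a; split=> //.
  move/Lambda0_emb: (v_in) => [x vx]; subst v; apply/(admissibleP va); split.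
    apply: (free_Fp2_leq p_char (n := g)); first by rewrite uphalfE; lia.
    apply: free_of_tau_closure (residue_expansion va) _ => // w.
    by rewrite v_tau.
  move=> j; have : dual (Dmod (emb x)) (emb x) by rewrite v_dual; apply: Dmod_gen.
  by apply; apply: Dmod_iter_F; apply: Dmod_gen.
have x_free : free_residue x.
  exists (a^~ 0%N); first exact: residue_expansion.
  apply: (free_all p_char g_gt0) => //.
  by have [] : admissible (emb x) a by apply/(admissibleP xa).
split; [exact: Dmod_lattice | exact: Dmod_tau_closure | exact: Dmod_dual].
Qed.

End Comparison.

(* k is an algebraic closure of F_p and W = W(k) *)
Theorem proposition3p17 (p : nat) (p_prime : prime p)
    (g : nat) (g_gt0 : (0 < g)%N)
    (k : closedFieldType) (iota : {rmorphism 'F_p -> k})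
    (k_alg : integralRange iota) (W : witt_ring p k) :
  (* every v in Lambda0 has a unique expansion *)
  (forall v : Nspace W g, Lambda0 W g v -> exists a, expansion v a) /\
  (forall (v : Nspace W g) a b, expansion v a -> expansion v b ->
     forall i l, (1 <= i <= g)%N -> a i l = b i l) /\
  (* the two sets agree *)
  [set v : Nspace W g |
     [/\ is_lattice (Dmod v), tau_closure (Dmod v) = Lambda0 W g
       & dual (Dmod v) = Dmod v]]
  = [set v : Nspace W g |
       Lambda0 W g v /\ exists a, expansion v a /\ admissible v a] /\
  (* the expansion of <v, F^j v> *)
  (forall (v : Nspace W g) a j, expansion v a ->
     forall m : nat, exists n0, forall n, (n0 <= n)%N ->
       pideal W m%:Z (pairing v (iter j Fmap v)
                   - pairing_sum W g a j n)) /\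
  (* The shape of the equations at level l.  The sign of z_i a_{i,0}^{sigma^j}
     in the reduction of <v, F^j v> is (-1)^(g-1+l): the factor (-1)^r of the
     expansion of <v, F^j v> contributes (-1)^l. *)
  (exists d : nat -> nat -> (nat -> nat -> k) -> k,
     [/\ (* d j l a only depends on the a i r with r < l, and on the a i l
            with i <= ceil((g+1)/2) *)
         forall j l a b,
           (forall i r, (1 <= i <= g)%N -> (r < l)%N -> a i r = b i r) ->
           (forall i, (1 <= i <= uphalf g.+1)%N -> a i l = b i l) ->
           d j l a = d j l b,
         forall j a, level_range g 0 j -> d j 0%N a = d0 p g a j
       & forall (v : Nspace W g) a l j, expansion v a -> level_range g l j ->
           (forall l' j', (l' < l)%N -> level_range g l' j' ->
              reduction_vanishes v l' j') ->
           pideal W (level g l j) (pairing v (iter j Fmap v)) /\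
           forall w : W,
             pairing v (iter j Fmap v)
               = p%:R ^ level g l j * tofrac w ->
             red W w = system_lhs p g ((-1) ^+ (g.-1 + l)) a l j - d j l a]) /\
  (* linear independence of all the a i 0 *)
  (forall a : nat -> nat -> k, leading_free p g a -> system0 p g a ->
     free_Fp2 p g (fun i => a i 0%N)).
Proof.
split; first exact: expansion_exists.
split; first by move=> v a b va vb i l; apply: expansion_unique.
split.
  apply/seteqP; split=> v Hv; first exact: (special_vectorsP p_prime g_gt0 v).1 Hv.
  exact: (special_vectorsP p_prime g_gt0 v).2 Hv.
split; first by move=> v a j; apply: pairing_sum_cvg.
split; last by move=> a; apply: (free_all (residue_char W p_prime) g_gt0).
exists (dcoef W g); split=> [j l a b||v a l j va lj IH].
- exact: dcoef_ext.
- by move=> j a _; apply: dcoef0.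
by apply: reduction_eq => // l' l'_lt lj'; apply: IH.
Qed.
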